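(* Let $r\ge 2$ and let $G$ be an $r$-partite graph with vertex partition $V_1\cup\cdots\cup V_r$, where $V_a=\{X_{a,1},\dots,X_{a,n}\}$ for all $a\in[r]$, satisfying the following conditions: (i) $\{X_{a,i},X_{b,i}\}$ is an edge for all $i\in[n]$ and $1\le a<b\le r$; (ii) if $\{X_{a,i},X_{b,j}\}$ is an edge with $1\le a<b\le r$, then $i\le j$; (iii) for $1\le a<b\le r$ and $i,j\in[n]$, $\{X_{a,i},X_{b,j}\}$ is an edge if and only if there exists a non-decreasing sequence $(t_1,t_2,\dots,t_k)$ of elements of $[n]$, with $k=b-a-1$, such that $\{X_{a,i},X_{a+1,t_1}\},\{X_{a+1,t_1},X_{a+2,t_2}\},\dots,\{X_{b-1,t_k},X_{b,j}\}$ are edges of $G$ (for $b=a+1$ the sequence is empty and the condition is vacuous); (iv) if $\{X_{a,i},X_{a+1,j}\}$ and $\{X_{a,j},X_{a+1,k}\}$ are edges, where $a\in[r-1]$ and $i,j,k\in[n]$, then $\{X_{a,i},X_{a+1,k}\}$ is an edge. Then $G$ is Cohen-Macaulay.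
   Context: $[m]=\{1,\dots,m\}$. Graphs are finite and simple. An $r$-partite graph with partition $V=V_1\cup\cdots\cup V_r$ (disjoint union) is a graph on $V$ in which no two vertices in the same $V_k$ are adjacent. Let ${\sf k}$ be a field and $S={\sf k}[X_{a,i}: a\in[r],i\in[n]]$, the polynomial ring whose variables are the vertices. The edge ideal is $I(G)=\langle xy : \{x,y\}\text{ an edge of }G\rangle\subset S$. $G$ is called Cohen-Macaulay if $S/I(G)$ is a Cohen-Macaulay ring. *)

(* Defs.v *)
From HB Require Import structures.
From mathcomp Require Import all_boot all_algebra.
From mathcomp Require Import boolp.
From mathcomp Require Import ring mpoly.

Set Implicit Arguments.
Unset Strict Implicit.
Unset Printing Implicit Defensive.

Import GRing.Theory.
Local Open Scope ring_scope.
Local Open Scope quotient_scope.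

Section Ideals.
Variable R : comNzRingType.
Implicit Types (s : seq R) (P : prime_idealr R).

Definition gen_ideal s : pred R := fun x =>
  `[< exists c : nat -> R, x = \sum_(i < size s) c i * s`_i >].

(* [idealr R] is the library's type of proper ideals; the unit ideal is
   generated by 1, so nothing is lost by leaving it out. *)
Definition noetherian : Prop :=
  forall I : idealr R, exists s, forall x, (x \in I) = (x \in gen_ideal s).

(* Among proper ideals. *)
Definition maximal_ideal (I : idealr R) : Prop :=
  forall J : idealr R, {subset I <= J} -> {subset J <= I}.

Definition is_local (m : idealr R) : Prop :=
  forall J : idealr R, maximal_ideal J <-> J =i m.

(* A strictly increasing chain [p 0, ..., p d] of prime ideals; the values of
   [p] beyond [d] are irrelevant. *)
Definition prime_chain (d : nat) (p : nat -> prime_idealr R) : Prop :=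
  forall i : nat, (i < d)%N ->
    {subset p i <= p i.+1} /\ exists2 x, x \in p i.+1 & x \notin p i.

Definition krull_dim (d : nat) : Prop :=
  (exists p, prime_chain d p) /\
  (forall d' p, prime_chain d' p -> (d' <= d)%N).

(* s`_i is a nonzerodivisor modulo the ideal generated by the previous terms,
   and the quotient by the whole sequence is nonzero. *)
Definition regular_seq s : Prop :=
  1 \notin gen_ideal s /\
  forall i, (i < size s)%N ->
    forall y, y * s`_i \in gen_ideal (take i s) -> y \in gen_ideal (take i s).

Definition depth (m : idealr R) (d : nat) : Prop :=
  (exists s, [/\ regular_seq s, {subset s <= m} & size s = d]) /\
  (forall s, regular_seq s -> {subset s <= m} -> (size s <= d)%N).

Definition local_cohen_macaulay : Prop :=
  exists (m : idealr R) (d : nat), [/\ is_local m, krull_dim d & depth m d].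

End Ideals.

(* Elements of [localization P] are classes of pairs (a, s) with s outside P,
   read as a / s. *)
Section Localization.
Variables (R : comNzRingType) (P : prime_idealr R).

Definition loc_pair := {x : R * R | x.2 \notin P}.
HB.instance Definition _ := Choice.on loc_pair.

Implicit Types x y z : loc_pair.

Definition loc_num x : R := (sval x).1.
Definition loc_den x : R := (sval x).2.

Lemma loc_denP x : loc_den x \notin P. Proof. exact: (svalP x). Qed.

Lemma notin_primeM (s t : R) : s \notin P -> t \notin P -> s * t \notin P.
Proof. by move=> sP tP; rewrite prime_idealrM negb_or sP. Qed.

Lemma notin_prime1 : 1 \notin P. Proof. by rewrite idealr1. Qed.

Definition loc_mk (a s : R) (sP : s \notin P) : loc_pair :=
  exist (fun x : R * R => x.2 \notin P) (a, s) sP.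

Definition loc_equiv x y : bool :=
  `[< exists2 u, u \notin P &
      u * (loc_num x * loc_den y) = u * (loc_num y * loc_den x) >].

Lemma loc_equiv_is_equiv : equiv_class_of loc_equiv.
Proof.
split=> [x|x y|y x z].
- by apply/asboolP; exists 1; rewrite ?idealr1.
- by apply/asboolP/asboolP => -[u uP e]; exists u.
move=> /asboolP[u uP e] /asboolP[v vP f]; apply/asboolP.
exists (u * v * loc_den y); first by rewrite !notin_primeM ?loc_denP.
have -> : u * v * loc_den y * (loc_num x * loc_den z) =
    (v * loc_den z) * (u * (loc_num x * loc_den y)) by ring.
have -> : u * v * loc_den y * (loc_num z * loc_den x) =
    (u * loc_den x) * (v * (loc_num z * loc_den y)) by ring.
by rewrite e -f; ring.
Qed.

Canonical loc_equiv_equiv := EquivRelPack loc_equiv_is_equiv.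
Canonical loc_equiv_encModRel := defaultEncModRel loc_equiv.

Definition localization := {eq_quot loc_equiv}.
HB.instance Definition _ : EqQuotient _ loc_equiv localization :=
  EqQuotient.on localization.
HB.instance Definition _ := Choice.on localization.

Definition loc_frac (a s : R) (sP : s \notin P) : localization :=
  \pi_localization (loc_mk a sP).

Lemma loc_frac_eq a s b t (sP : s \notin P) (tP : t \notin P) :
  loc_frac a sP = loc_frac b tP <->
  exists2 u, u \notin P & u * (a * t) = u * (b * s).
Proof.
split=> [/eqP|h]; first by rewrite /loc_frac piE => /asboolP.
by apply/eqP; rewrite /loc_frac piE; apply/asboolP.
Qed.

Lemma loc_frac_surj (x : localization) :
  exists a s (sP : s \notin P), x = loc_frac a sP.
Proof.
exists (loc_num (repr x)), (loc_den (repr x)), (loc_denP (repr x)).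
rewrite -{1}[x]reprK /loc_frac; congr (\pi _).
by apply: val_inj => /=; rewrite /loc_num /loc_den -surjective_pairing.
Qed.

Definition loc_pair_add x y : loc_pair :=
  loc_mk (loc_num x * loc_den y + loc_num y * loc_den x)
         (notin_primeM (loc_denP x) (loc_denP y)).
Definition loc_pair_opp x : loc_pair := loc_mk (- loc_num x) (loc_denP x).
Definition loc_pair_mul x y : loc_pair :=
  loc_mk (loc_num x * loc_num y) (notin_primeM (loc_denP x) (loc_denP y)).

Definition loc_zero : localization := loc_frac 0 notin_prime1.
Definition loc_one : localization := loc_frac 1 notin_prime1.
Definition loc_add (x y : localization) : localization :=
  \pi_localization (loc_pair_add (repr x) (repr y)).
Definition loc_opp (x : localization) : localization :=
  \pi_localization (loc_pair_opp (repr x)).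
Definition loc_mul (x y : localization) : localization :=
  \pi_localization (loc_pair_mul (repr x) (repr y)).

Lemma loc_repr a s (sP : s \notin P) : exists2 u, u \notin P &
  u * (loc_num (repr (loc_frac a sP)) * s) =
  u * (a * loc_den (repr (loc_frac a sP))).
Proof.
apply/(loc_frac_eq _ _ (loc_denP _)); rewrite /loc_frac.
rewrite -[RHS]reprK; congr (\pi _).
by apply: val_inj => /=; rewrite /loc_num /loc_den -surjective_pairing.
Qed.

Lemma loc_fracD a s b t (sP : s \notin P) (tP : t \notin P) :
  loc_add (loc_frac a sP) (loc_frac b tP) =
  loc_frac (a * t + b * s) (notin_primeM sP tP).
Proof.
have [u uP e] := loc_repr a sP; have [v vP f] := loc_repr b tP.
apply/loc_frac_eq; exists (u * v); first exact: notin_primeM.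
set x := repr _ in e *; set y := repr _ in f *.
transitivity (v * (loc_den y * t) * (u * (loc_num x * s)) +
              u * (loc_den x * s) * (v * (loc_num y * t))); first by ring.
by rewrite e f; ring.
Qed.

Lemma loc_fracN a s (sP : s \notin P) :
  loc_opp (loc_frac a sP) = loc_frac (- a) sP.
Proof.
have [u uP e] := loc_repr a sP; apply/loc_frac_eq; exists u => //.
by rewrite mulNr mulrN e; ring.
Qed.

Lemma loc_fracM a s b t (sP : s \notin P) (tP : t \notin P) :
  loc_mul (loc_frac a sP) (loc_frac b tP) =
  loc_frac (a * b) (notin_primeM sP tP).
Proof.
have [u uP e] := loc_repr a sP; have [v vP f] := loc_repr b tP.
apply/loc_frac_eq; exists (u * v); first exact: notin_primeM.
set x := repr _ in e *; set y := repr _ in f *.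
transitivity ((u * (loc_num x * s)) * (v * (loc_num y * t))); first by ring.
by rewrite e f; ring.
Qed.

Lemma loc_frac_ext a s b t (sP : s \notin P) (tP : t \notin P) :
  a * t = b * s -> loc_frac a sP = loc_frac b tP.
Proof. by move=> e; apply/loc_frac_eq; exists 1; rewrite ?idealr1 ?e. Qed.

Lemma loc_addA : associative loc_add.
Proof.
move=> x y z; have [a [s [sP ->]]] := loc_frac_surj x.
have [b [t [tP ->]]] := loc_frac_surj y.
have [c [w [wP ->]]] := loc_frac_surj z.
by rewrite !loc_fracD; apply: loc_frac_ext; ring.
Qed.

Lemma loc_addC : commutative loc_add.
Proof.
move=> x y; have [a [s [sP ->]]] := loc_frac_surj x.
have [b [t [tP ->]]] := loc_frac_surj y.
by rewrite !loc_fracD; apply: loc_frac_ext; ring.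
Qed.

Lemma loc_add0 : left_id loc_zero loc_add.
Proof.
move=> x; have [a [s [sP ->]]] := loc_frac_surj x.
by rewrite loc_fracD; apply: loc_frac_ext; ring.
Qed.

Lemma loc_addN : left_inverse loc_zero loc_opp loc_add.
Proof.
move=> x; have [a [s [sP ->]]] := loc_frac_surj x.
by rewrite loc_fracN loc_fracD; apply: loc_frac_ext; ring.
Qed.

HB.instance Definition _ :=
  GRing.isZmodule.Build localization loc_addA loc_addC loc_add0 loc_addN.

Lemma loc_mulA : associative loc_mul.
Proof.
move=> x y z; have [a [s [sP ->]]] := loc_frac_surj x.
have [b [t [tP ->]]] := loc_frac_surj y.
have [c [w [wP ->]]] := loc_frac_surj z.
by rewrite !loc_fracM; apply: loc_frac_ext; ring.
Qed.

Lemma loc_mulC : commutative loc_mul.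
Proof.
move=> x y; have [a [s [sP ->]]] := loc_frac_surj x.
have [b [t [tP ->]]] := loc_frac_surj y.
by rewrite !loc_fracM; apply: loc_frac_ext; ring.
Qed.

Lemma loc_mul1 : left_id loc_one loc_mul.
Proof.
move=> x; have [a [s [sP ->]]] := loc_frac_surj x.
by rewrite loc_fracM; apply: loc_frac_ext; ring.
Qed.

Lemma loc_mulDl : left_distributive loc_mul loc_add.
Proof.
move=> x y z; have [a [s [sP ->]]] := loc_frac_surj x.
have [b [t [tP ->]]] := loc_frac_surj y.
have [c [w [wP ->]]] := loc_frac_surj z.
by rewrite loc_fracD !loc_fracM loc_fracD; apply: loc_frac_ext; ring.
Qed.

Lemma loc_one_neq0 : loc_one != 0.
Proof.
apply/eqP => /loc_frac_eq[u uP]; rewrite mul0r !mulr1 mulr0 => u0.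
by move: uP; rewrite u0 idealr0.
Qed.

HB.instance Definition _ := GRing.Zmodule_isComNzRing.Build localization
  loc_mulA loc_mulC loc_mul1 loc_mulDl loc_one_neq0.

End Localization.

(* Every maximal ideal is prime, so [P] ranges over all maximal ideals. *)
Definition cohen_macaulay (R : comNzRingType) : Prop :=
  noetherian R /\
  forall P : prime_idealr R,
    maximal_ideal P -> local_cohen_macaulay (localization P).

Record sgraph (V : finType) := SGraph {
  adj :> rel V;
  adj_sym : ssrbool.symmetric adj;
  adj_irrefl : irreflexive adj
}.

Section EdgeIdeal.
Variables (k : fieldType) (V : finType) (G : sgraph V).

Definition vertex_var (v : V) : {mpoly k[#|V|]} := 'X_(enum_rank v).

Definition edge_monomials : seq {mpoly k[#|V|]} :=
  [seq vertex_var e.1 * vertex_var e.2 | e <- enum [pred e : V * V | G e.1 e.2]].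

Definition edge_ideal : {mpoly k[#|V|]} -> bool := gen_ideal edge_monomials.

Lemma edge_ideal_closed : idealr_closed edge_ideal.
Proof.
split; first by apply/asboolP; exists (fun=> 0); rewrite big1 // => i; rewrite mul0r.
  apply/asboolP => -[c /(congr1 (meval (fun=> 0)))].
  rewrite rmorph1 rmorph_sum /= big1 => [|i _]; first by move/eqP; rewrite oner_eq0.
  have /mapP[e _ ->] : edge_monomials`_i \in edge_monomials by exact: mem_nth.
  by rewrite !rmorphM /= mevalXU mul0r mulr0.
move=> a p q /asboolP[c ->] /asboolP[d ->]; apply/asboolP.
exists (fun i => a * c i + d i); rewrite mulr_sumr -big_split /=.
by apply: eq_bigr => i _; rewrite mulrDl mulrA.
Qed.

HB.instance Definition _ := isIdealr.Build {mpoly k[#|V|]} edge_ideal edge_ideal_closed.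

Definition graph_cohen_macaulay : Prop :=
  cohen_macaulay {ideal_quot (edge_ideal : idealr {mpoly k[#|V|]})}.

End EdgeIdeal.

(* For w = [:: w_0; ...; w_m], says that {X_(a+l, w_l), X_(a+l+1, w_(l+1))} is
   an edge for every l < m; [c] and [d] are a+l and a+l+1 as elements of 'I_r. *)
Definition edge_walk (r n : nat) (G : sgraph ('I_r * 'I_n)%type)
    (a : 'I_r) (w : seq 'I_n) : Prop :=
  forall (x0 : 'I_n) (l : nat) (c d : 'I_r), (l.+1 < size w)%N ->
    c = (a + l)%N :> nat -> d = (a + l).+1 :> nat ->
    G (c, nth x0 w l) (d, nth x0 w l.+1).

(* Main.v *)
From HB Require Import structures.
Require Import Defs.
From mathcomp Require Import boolp classical_sets.
From mathcomp Require Import all_boot all_algebra.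
From mathcomp Require Import zify ring mpoly.

(** Write S for the polynomial ring, I for the edge ideal, and theta_t for the
sum of the variables in column t, the n columns being the sets of vertices with
the same second index.  Each column is a clique, and there are two parts to the
argument.

Combinatorics.  The independence complex of G can be built from transversals of
the columns by repeatedly splitting at a vertex v into the faces compatible with
v and the faces avoiding v ([decomposable_independent]).  The columns are treated
in increasing order.  Hypothesis [h2] makes the topmost vertex of the first
remaining column simplicial, and its column neighbours are deleted one by one;
keeping one of them instead removes all the vertices of later columns above it.
Hypotheses [h3] and [h4] say that the sets removed in this way are stable under
further steps, which is what keeps the topmost vertices simplicial.

Algebra.  Splitting at v corresponds to the exact sequence
0 -> S/(J : X_v) -> S/J -> S/(J + X_v) -> 0, along which regularity of a fixed
sequence passes from the outer terms to the middle one
([weakly_regular_extension]).  When the complex is the simplex on a transversal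
F, theta_t is congruent to the one variable of F in column t.  Hence, for any
nonzero univariate polynomials f_t, each f_t(theta_t) is a nonzerodivisor modulo I
and the previous ones: on the simplices these are polynomials in distinct variables
([decomposable_weakly_regular]).

Given a maximal ideal P of R = S/I, Zariski's lemma makes each theta_t algebraic
over k modulo P, so the f_t can be chosen with f_t(theta_t) in P.  This gives a
regular sequence of length n in the maximal ideal of R_P.  Conversely a chain of
primes of R_P has length at most n, because a prime containing I contains all
variables of each column but at most one, and so the chain lives in a quotient of
a polynomial ring in n variables ([localization_dim]).  Since a regular sequence
of length d in a prime ideal always produces a chain of d + 1 primes
([regular_prime_chain]), both the dimension and the depth of R_P equal n.  The
ring R is noetherian by the basis theorem. *)

Set Implicit Arguments.
Unset Strict Implicit.
Unset Printing Implicit Defensive.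

Import GRing.Theory.

(** * Ideals, and chains of primes from regular sequences *)

Section Ideals.
Local Open Scope ring_scope.
Variable R : comNzRingType.
Implicit Types (J P T : R -> Prop) (s : seq R) (x y z g : R).

(** The unit ideal is allowed, unlike in the structure of proper ideals: the sums
and colon ideals below may be improper. *)
Definition ideal J := J 0 /\ forall a x y, J x -> J y -> J (a * x + y).

Lemma ideal0 J : ideal J -> J 0. Proof. by case. Qed.

Lemma idealZ J a x : ideal J -> J x -> J (a * x).
Proof. by case=> J0 JD Jx; rewrite -[_ * _]addr0; apply: JD. Qed.

Lemma idealZr J a x : ideal J -> J x -> J (x * a).
Proof. by move=> iJ Jx; rewrite mulrC; apply: idealZ. Qed.

Lemma idealD J x y : ideal J -> J x -> J y -> J (x + y).
Proof. by case=> _ JD Jx Jy; rewrite -[x]mul1r; apply: JD. Qed.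

Lemma idealN J x : ideal J -> J x -> J (- x).
Proof. by move=> iJ Jx; rewrite -mulN1r; apply: idealZ. Qed.

Lemma idealB J x y : ideal J -> J x -> J y -> J (x - y).
Proof. by move=> iJ Jx Jy; apply: idealD => //; apply: idealN. Qed.

Lemma ideal_sum J (I : Type) (r : seq I) (Q : pred I) (F : I -> R) :
  ideal J -> (forall i, Q i -> J (F i)) -> J (\sum_(i <- r | Q i) F i).
Proof.
move=> iJ JF; elim/big_rec: _ => [|i x Qi Jx]; first exact: ideal0.
by apply: idealD => //; apply: JF.
Qed.

Lemma ideal_idealr (I : idealr R) : ideal (fun x => x \in I).
Proof.
by split=> [|a x y xI yI]; rewrite ?rpred0 ?rpredD ?ring_quotient.idealMr.
Qed.

Lemma ideal_gen s : ideal (fun x => x \in gen_ideal s).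
Proof.
split; first by apply/asboolP; exists (fun=> 0); rewrite big1 // => i; rewrite mul0r.
move=> a x y /asboolP[c ->] /asboolP[d ->]; apply/asboolP.
exists (fun i => a * c i + d i); rewrite mulr_sumr -big_split /=.
by apply: eq_bigr => i _; rewrite mulrDl mulrA.
Qed.

Lemma mem_gen_ideal s g : g \in s -> g \in gen_ideal s.
Proof.
move=> gs; apply/asboolP; exists (fun i => (i == index g s)%:R).
have gi : (index g s < size s)%N by rewrite index_mem.
rewrite (bigD1 (Ordinal gi)) //= eqxx mul1r nth_index // big1 ?addr0 // => i.
by rewrite -val_eqE /= => /negPf->; rewrite mul0r.
Qed.

Lemma gen_ideal_min J s x :
  ideal J -> (forall g, g \in s -> J g) -> x \in gen_ideal s -> J x.
Proof.
move=> iJ sJ /asboolP[c ->]; apply: ideal_sum => // i _.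
by apply: idealZ => //; apply: sJ; apply: mem_nth.
Qed.

Lemma gen_ideal_rcons s g x :
  x \in gen_ideal (rcons s g) <->
  exists2 y, y \in gen_ideal s & exists z, x = y + z * g.
Proof.
split=> [/asboolP[c ->]|[y ys [z ->]]].
  rewrite size_rcons big_ord_recr /= nth_rcons ltnn eqxx.
  eexists; last by eexists.
  apply: (@ideal_sum (fun y => y \in gen_ideal s)) => [|i _]; first exact: ideal_gen.
  apply: (@idealZ (fun y => y \in gen_ideal s)); first exact: ideal_gen.
  by rewrite nth_rcons ltn_ord; apply: mem_gen_ideal; apply: mem_nth.
apply: (@idealD (fun y => y \in gen_ideal (rcons s g))); first exact: ideal_gen.
  apply: (@gen_ideal_min (fun y => y \in gen_ideal (rcons s g)) _ _ _ _ ys).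
    exact: ideal_gen.
  by move=> h hs; apply: mem_gen_ideal; rewrite mem_rcons inE hs orbT.
apply: (@idealZ (fun y => y \in gen_ideal (rcons s g))); first exact: ideal_gen.
by apply: mem_gen_ideal; rewrite mem_rcons mem_head.
Qed.

Definition prime_ideal P :=
  [/\ ideal P, ~ P 1 & forall x y, P (x * y) -> P x \/ P y].

(** Passage from ideals given by propositions to the boolean structures. *)
Section PredIdeals.
Variable J : R -> Prop.

Definition bool_pred : R -> bool := fun x => `[< J x >].

Hypotheses (iJ : ideal J) (J1 : ~ J 1).

Fact bool_pred_idealr : idealr_closed bool_pred.
Proof.
split; first by apply/asboolP; apply: ideal0.
  by apply/asboolP.
by move=> a x y /asboolP Jx /asboolP Jy; apply/asboolP; apply: iJ.2.
Qed.

HB.instance Definition _ := isIdealr.Build R bool_pred bool_pred_idealr.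

Lemma exists_idealr : exists I : idealr R, forall x, x \in I <-> J x.
Proof. by exists (bool_pred : idealr R) => x; split=> /asboolP. Qed.

Hypothesis JM : forall x y, J (x * y) -> J x \/ J y.

Fact bool_pred_prime : prime_idealr_closed bool_pred.
Proof. by move=> x y /asboolP/JM[] h; apply/orP; [left|right]; apply/asboolP. Qed.

HB.instance Definition _ := isPrimeIdealrClosed.Build R bool_pred bool_pred_prime.

Lemma exists_prime_idealr : exists Q : prime_idealr R, forall x, x \in Q <-> J x.
Proof. by exists (bool_pred : prime_idealr R) => x; split=> /asboolP. Qed.

End PredIdeals.

Lemma prime_ideal_idealr (Q : prime_idealr R) : prime_ideal (fun x => x \in Q).
Proof.
split; [exact: ideal_idealr|by rewrite idealr1|].
by move=> x y; rewrite prime_idealrM => /orP.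
Qed.

Lemma prime_ideal_exp P x n : prime_ideal P -> P (x ^+ n) -> P x.
Proof.
case=> _ P1 PM; elim: n => [/P1//|n IHn].
by rewrite exprS => /PM[|/IHn].
Qed.

(** Krull's argument: an ideal maximal among those that contain J and miss the
multiplicative set T is prime, for if neither x nor y lies in it then T meets both
of the ideals it generates with x and with y, hence also the one generated with
x * y. *)
Lemma prime_avoiding J T :
  ideal J -> T 1 -> (forall x y, T x -> T y -> T (x * y)) ->
  (forall x, J x -> ~ T x) ->
  exists P : prime_idealr R,
    (forall x, J x -> x \in P) /\ (forall x, T x -> x \notin P).
Proof.
move=> iJ T1 TM JT.
pose good (A : set R) := [/\ ideal A, forall x, J x -> A x & forall x, A x -> ~ T x].
have [F Fgood Ftot|P [Pgood Pmax]] :=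
    @Zorn_bigcup R (fun A => A = classical_sets.set0 \/ good A).
  (* The empty set is admitted so that the union of the empty chain qualifies. *)
  have [[A0 FA0 gA0]|nF] := pselect (exists2 A, F A & good A); last first.
    left; apply/seteqP; split=> x //= -[A FA Ax].
    have [A0|gA] := Fgood A FA; first by rewrite A0 in Ax.
    by case: nF; exists A.
  right; case: (gA0) => iA0 JA0 A0T.
  have gx A x : F A -> A x -> good A.
    by move=> FA Ax; have [A0'|//] := Fgood A FA; rewrite A0' in Ax.
  split.
  - split; first by exists A0 => //; apply: ideal0.
    move=> a x y [A FA Ax] [B FB By].
    have [/= AB|/= BA] := Ftot A B FA FB.
      have [iB _ _] := gx _ _ FB By.
      by exists B => //; apply: iB.2 => //; apply: AB.
    have [iA _ _] := gx _ _ FA Ax.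
    by exists A => //; apply: iA.2 => //; apply: BA.
  - by move=> x Jx; exists A0 => //; apply: JA0.
  - by move=> x [A FA Ax]; have [_ _] := gx _ _ FA Ax; apply.
have gP : good P.
  case: Pgood => // P0; case: (Pmax J); last by right.
  split; first by rewrite P0; apply: classical_sets.sub0set.
  by move=> h; have := h 0 (ideal0 iJ); rewrite P0.
have [iP JP PT] := gP.
have adj x : ~ P x -> exists a p, P p /\ T (p + a * x).
  move=> nPx; apply: contrapT => nT; case: (Pmax (fun u => exists a p, P p /\ u = p + a * x)).
    split; first by move=> p Pp; exists 0, p; rewrite mul0r addr0.
    move=> h; apply: nPx; apply: h => /=; exists 1, 0.
    by rewrite add0r mul1r; split=> //; apply: ideal0.
  right; split.
  - split=> [|a u v [b [p [Pp ->]]] [c [q [Pq ->]]]].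
      by exists 0, 0; rewrite mul0r addr0; split=> //; apply: ideal0.
    exists (a * b + c), (a * p + q); split; first by apply: iP.2.
    by ring.
  - by move=> u Ju; exists 0, u; rewrite mul0r addr0; split=> //; apply: JP.
  - by move=> u [a [p [Pp ->]]] Tu; apply: nT; exists a, p.
have P1 : ~ P 1 by move=> P1; apply: (PT 1).
have PM x y : P (x * y) -> P x \/ P y.
  move=> Pxy; apply: contrapT => /not_orP[/adj[a [p [Pp Tx]]] /adj[b [q [Pq Ty]]]].
  apply: PT (TM _ _ Tx Ty).
  have -> : (p + a * x) * (q + b * y) =
            (q + b * y) * p + (a * x * q + a * b * (x * y)) by ring.
  by apply: iP.2 => //; apply: iP.2 => //; apply: idealZ.
have [Q QP] := exists_prime_idealr iP P1 PM.
exists Q; split=> x; first by move/JP/QP.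
by move=> Tx; apply/negP => /QP /PT.
Qed.

(** This yields depth <= dimension over any ring.  If g is the last term of the
sequence, the set of all u * g ^ n with u outside P misses the ideal of the
previous terms, because g is regular modulo them; a prime avoiding that set is
contained in P, and strictly so since it misses g. *)
Lemma regular_prime_chain s (P : prime_idealr R) :
  regular_seq s -> {subset s <= P} ->
  exists2 p, prime_chain (size s) p & p (size s) =i P.
Proof.
case=> _; elim/last_ind: s P => [|s g IHs] P reg sP.
  by exists (fun=> P) => //.
pose T x := exists u n, u \notin P /\ x = u * g ^+ n.
have sg : g \in P by apply: sP; rewrite mem_rcons mem_head.
have regg y : y * g \in gen_ideal s -> y \in gen_ideal s.
  have := reg (size s); rewrite size_rcons leqnn => /(_ isT y).
  by rewrite nth_rcons ltnn eqxx -cats1 take_size_cat.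
have [|x y [u [n [uP ->]]] [v [m [vP ->]]]|x xs [u [n [uP xE]]]|Q [sQ QT]] :=
    @prime_avoiding _ T (ideal_gen s).
- by exists 1, 0%N; rewrite mulr1 idealr1.
- exists (u * v), (n + m)%N.
  by rewrite notin_primeM //; split=> //; rewrite exprD; ring.
- case/negP: uP; suff us : u \in gen_ideal s.
    apply: (@gen_ideal_min (fun y => y \in P) _ _ _ _ us); first exact: ideal_idealr.
    by move=> h hs; apply: sP; rewrite mem_rcons inE hs orbT.
  rewrite xE in xs; elim: n xs {xE} => [|n IHn]; first by rewrite mulr1.
  by rewrite exprSr mulrA => /regg.
have QP : {subset Q <= P}.
  move=> x xQ; apply: contraLR xQ => xP; apply: QT.
  by exists x, 0%N; rewrite mulr1.
have gQ : g \notin Q.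
  by apply: QT; exists 1, 1%N; rewrite mul1r idealr1.
have [i ilt y|x xs|p pch pQ] := IHs Q.
- have := reg i; rewrite size_rcons ltnS ltnW // => /(_ isT y).
  by rewrite nth_rcons ilt -cats1 takel_cat // ltnW.
- by apply: sQ; apply: mem_gen_ideal.
exists (fun i => if (i <= size s)%N then p i else P); last first.
  by rewrite size_rcons ltnn.
rewrite size_rcons => i; rewrite ltnS leq_eqVlt => /orP[/eqP->|ilt] /=.
  rewrite eqxx ltnn; split=> [x|]; first by rewrite pQ => /QP.
  by exists g; rewrite ?pQ.
by rewrite ilt orbT; apply: pch.
Qed.

End Ideals.

(** * Finitely generated algebras and the basis theorem *)

Section FinGen.
Local Open Scope ring_scope.

(** K is a finitely generated A-algebra through f, phrased as an induction
principle so that no multivariate polynomials are needed. *)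
Definition generated_over (A K : comNzRingType) (f : A -> K) (xs : seq K) :=
  forall B : K -> Prop,
    (forall a, B (f a)) -> (forall x, x \in xs -> B x) ->
    (forall x y, B x -> B y -> B (x + y)) ->
    (forall x y, B x -> B y -> B (x * y)) -> forall y, B y.

Lemma generated_over_nil (A K : comNzRingType) (f : {rmorphism A -> K}) :
  generated_over f [::] -> forall y, exists a, f a = y.
Proof.
move=> gen; apply: gen => [a||x y [a <-] [b <-]|x y [a <-] [b <-]] //.
- by exists a.
- by exists (a + b); rewrite rmorphD.
- by exists (a * b); rewrite rmorphM.
Qed.

(** Evaluation at x as a map from A[X]; generators are absorbed one at a time by
replacing the base ring A with A[X]. *)
Definition adjoin (A K : comNzRingType) (f : {rmorphism A -> K}) (x : K) :
  {rmorphism {poly A} -> K} := horner_morph (fun a => mulrC x (f a)).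

Lemma adjoinC (A K : comNzRingType) (f : {rmorphism A -> K}) x a :
  adjoin f x a%:P = f a.
Proof. exact: horner_morphC. Qed.

Lemma adjoinX (A K : comNzRingType) (f : {rmorphism A -> K}) x :
  adjoin f x 'X = x.
Proof. exact: horner_morphX. Qed.

Lemma generated_over_cons (A K : comNzRingType) (f : {rmorphism A -> K}) x xs :
  generated_over f (x :: xs) -> generated_over (adjoin f x) xs.
Proof.
move=> gen B Bf Bxs BD BM; apply: gen => // [a|y].
  by rewrite -(adjoinC f x).
by rewrite inE => /predU1P[->|/Bxs//]; rewrite -(adjoinX f x).
Qed.

End FinGen.

Section Noetherian.
Local Open Scope ring_scope.

(** Over all ideals, the unit ideal included, so that the property is visibly
inherited by images and polynomial rings. *)
Definition ideals_fg (R : comNzRingType) := forall J : R -> Prop, ideal J ->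
  exists2 s : seq R, (forall g, g \in s -> J g) & (forall x, J x -> x \in gen_ideal s).

Lemma ideals_fg_noetherian R : ideals_fg R -> noetherian R.
Proof.
move=> fgR I; have [s sI Is] := fgR _ (ideal_idealr I).
exists s => x; apply/idP/idP; first exact: Is.
exact: (@gen_ideal_min _ (fun x => x \in I) _ _ (ideal_idealr I)).
Qed.

Lemma ideals_fg_field (k : fieldType) : ideals_fg k.
Proof.
move=> J iJ; have [[x Jx x0]|nJ] := pselect (exists2 x, J x & x != 0).
  exists [:: x] => [g|y _]; first by rewrite inE => /eqP->.
  rewrite -[y](divfK x0); apply: (@idealZ _ (fun y => y \in gen_ideal [:: x])).
    exact: ideal_gen.
  by apply: mem_gen_ideal; rewrite mem_head.
exists [::] => // x Jx; have [->|x0] := eqVneq x 0; first by case: (ideal_gen (Nil k)).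
by case: nJ; exists x.
Qed.

Lemma ideals_fg_surj (A B : comNzRingType) (f : {rmorphism A -> B}) :
  (forall y, exists x, f x = y) -> ideals_fg A -> ideals_fg B.
Proof.
move=> fsurj fgA J iJ.
have [|s sJ Js] := fgA (fun x => J (f x)).
  split=> [|a x y Jx Jy]; first by rewrite rmorph0; apply: ideal0.
  by rewrite rmorphD rmorphM; apply: iJ.2.
exists (map f s) => [_ /mapP[g gs ->]|y]; first exact: sJ.
have [x <-] := fsurj y => /Js.
apply: (@gen_ideal_min _ (fun x => f x \in gen_ideal (map f s))).
  have iB := ideal_gen (map f s).
  split=> [|a u v fu fv]; first by rewrite rmorph0; apply: iB.1.
  by rewrite rmorphD rmorphM; apply: iB.2.
by move=> g gs; apply: mem_gen_ideal; apply: map_f.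
Qed.

(** Hilbert's proof.  The coefficients of degree d of the elements of J of degree
at most d form an increasing chain of ideals of R, whose union is finitely
generated and hence reached at some stage N.  Polynomials of degree above N are
reduced by shifting those of degree N; the others are handled by generators of
the first N + 1 ideals. *)
Section HilbertBasis.
Variable R : comNzRingType.
Hypothesis fgR : ideals_fg R.
Variable J : {poly R} -> Prop.
Hypothesis iJ : ideal J.

Let lead d (a : R) := exists p, [/\ J p, (size p <= d.+1)%N & p`_d = a].

Let lead_ideal d : ideal (lead d).
Proof.
split; first by exists 0; rewrite size_poly0 coef0; split=> //; apply: ideal0.
move=> a _ _ [p [Jp sp <-]] [q [Jq sq <-]]; exists (a%:P * p + q); split.
- exact: iJ.2.
- rewrite (leq_trans (size_polyD _ _)) // geq_max sq andbT mul_polyC.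
  exact: leq_trans (size_scale_leq _ _) sp.
- by rewrite coefD coefCM.
Qed.

Let lead_mono d e a : (d <= e)%N -> lead d a -> lead e a.
Proof.
move=> de [p [Jp sp <-]]; exists ('X^(e - d) * p); split; first exact: idealZ.
  rewrite (leq_trans (size_polyMleq _ _)) // size_polyXn addSn /=.
  by rewrite -[in leqRHS](subnK de) -addnS leq_add2l.
by rewrite coefXnM ltnNge leq_subr /= subKn.
Qed.

Let lead_gens d : exists2 s : seq {poly R}, (forall g, g \in s -> J g) &
  forall p, J p -> (size p <= d.+1)%N ->
    exists2 q, q \in gen_ideal s & (size (p - q)%R <= d)%N.
Proof.
have [s sL Ls] := fgR (lead_ideal d).
have [t tJ ts] : exists2 t : seq {poly R}, (forall g, g \in t -> J g) &
    forall a, a \in s -> exists2 p, p \in t & (size p <= d.+1)%N /\ p`_d = a.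
  elim: s sL {Ls} => [|a s IHs] sL; first by exists [::].
  have [|t tJ ts] := IHs; first by move=> g gs; apply: sL; rewrite inE gs orbT.
  have [p [Jp sp pa]] := sL a (mem_head _ _).
  exists (p :: t) => [g|b]; first by rewrite inE => /predU1P[->|/tJ].
  rewrite inE => /predU1P[->|/ts[q qt [sq qb]]]; first by exists p; rewrite ?mem_head.
  by exists q; rewrite ?inE ?qt ?orbT.
exists t => // p Jp sp.
pose L a := exists q, [/\ q \in gen_ideal t, (size q <= d.+1)%N & q`_d = a].
have iL : ideal L.
  have iT := ideal_gen t; split.
    by exists 0; rewrite size_poly0 coef0; split=> //; apply: iT.1.
  move=> a _ _ [q [Jq sq <-]] [r [Jr sr <-]]; exists (a%:P * q + r); split.
  - exact: iT.2.
  - rewrite (leq_trans (size_polyD _ _)) // geq_max sr andbT mul_polyC.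
    exact: leq_trans (size_scale_leq _ _) sq.
  - by rewrite coefD coefCM.
have sL' a : a \in s -> L a.
  by move=> /ts[q qt [sq qa]]; exists q; split=> //; apply: mem_gen_ideal.
have /(gen_ideal_min iL sL')[q [qt sq qp]] : p`_d \in gen_ideal s.
  by apply: Ls; exists p.
exists q => //; apply/leq_sizeP => j; rewrite leq_eqVlt => /predU1P[<-|dj].
  by rewrite coefB qp subrr.
by rewrite coefB !nth_default ?subrr //; apply: leq_trans dj.
Qed.

Let low_gens d : exists2 s : seq {poly R}, (forall g, g \in s -> J g) &
  forall p, J p -> (size p <= d)%N -> p \in gen_ideal s.
Proof.
elim: d => [|d [s sJ Js]].
  exists [::] => // p _; rewrite leqn0 size_poly_eq0 => /eqP->.
  exact: (ideal_gen _).1.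
have [t tJ Jt] := lead_gens d.
have sub u : {subset u <= s ++ t} -> forall p, p \in gen_ideal u -> p \in gen_ideal (s ++ t).
  move=> us p; apply: (@gen_ideal_min _ (fun p => p \in gen_ideal (s ++ t))).
    exact: ideal_gen.
  by move=> g /us; apply: mem_gen_ideal.
exists (s ++ t) => [g|p Jp sp]; first by rewrite mem_cat => /orP[/sJ|/tJ].
have [q qt spq] := Jt p Jp sp.
have Jq : J q by apply: gen_ideal_min qt.
rewrite -[p](subrK q); apply: (@idealD _ (fun p => p \in gen_ideal (s ++ t))).
- exact: ideal_gen.
- by apply: (sub s) => [g gs|]; rewrite ?mem_cat ?gs // Js //; apply: idealB.
- by apply: (sub t) => // g gt; rewrite mem_cat gt orbT.
Qed.

Lemma hilbert_basis_ideal :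
  exists2 s : seq {poly R}, (forall g, g \in s -> J g) & (forall x, J x -> x \in gen_ideal s).
Proof.
pose L a := exists d, lead d a.
have iL : ideal L.
  split; first by exists 0%N; apply: (lead_ideal _).1.
  move=> a x y [d Lx] [e Ly]; exists (maxn d e).
  by apply: (lead_ideal _).2; [apply: lead_mono Lx|apply: lead_mono Ly];
    rewrite (leq_maxl, leq_maxr).
have [s sL Ls] := fgR iL.
(* N is a stage at which all generators of the union are already present. *)
have [N sN] : exists N, forall a, a \in s -> lead N a.
  elim: s sL {Ls} => [|a s IHs] sL; first by exists 0%N.
  have [|N sN] := IHs; first by move=> g gs; apply: sL; rewrite inE gs orbT.
  have [d La] := sL a (mem_head _ _); exists (maxn d N) => b.
  rewrite inE => /predU1P[->|/sN Lb]; first exact: lead_mono (leq_maxl _ _) La.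
  exact: lead_mono (leq_maxr _ _) Lb.
have [t tJ Jt] := low_gens N.+1; exists t => // p.
have [m] := ubnP (size p); elim: m p => // m IHm p; rewrite ltnS => spm Jp.
have [/(Jt p Jp)//|Np] := leqP (size p) N.+1.
pose d := (size p).-1; have dE : size p = d.+1 by rewrite prednK // (leq_trans _ Np).
have /(gen_ideal_min (lead_ideal N) sN)[q [Jq sq qN]] : p`_d \in gen_ideal s.
  by apply: Ls; exists d, p; rewrite dE.
have Nd : (N <= d)%N by rewrite -ltnS -dE ltnW.
rewrite -[p](subrK ('X^(d - N) * q)).
apply: (@idealD _ (fun p => p \in gen_ideal t)); first exact: ideal_gen.
  apply: IHm; last by apply: idealB => //; apply: idealZ.
  rewrite (leq_trans _ spm) // dE ltnS; apply/leq_sizeP => j.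
  rewrite coefB coefXnM leq_eqVlt => /predU1P[<-|dj].
    by rewrite ltnNge leq_subr /= subKn // qN subrr.
  rewrite ltnNge (leq_trans (leq_subr _ _) (ltnW dj)) /= nth_default ?dE // sub0r.
  rewrite nth_default ?oppr0 // (leq_trans sq) //.
  by rewrite ltn_subRL subnK.
apply: (@idealZ _ (fun p => p \in gen_ideal t)); first exact: ideal_gen.
exact: Jt.
Qed.

End HilbertBasis.

Lemma ideals_fg_poly (R : comNzRingType) : ideals_fg R -> ideals_fg {poly R}.
Proof. by move=> fgR J iJ; apply: hilbert_basis_ideal. Qed.

Lemma ideals_fg_generated (A K : comNzRingType) (f : {rmorphism A -> K}) xs :
  ideals_fg A -> generated_over f xs -> ideals_fg K.
Proof.
elim: xs A f => [|x xs IHxs] A f fgA genf.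
  exact: ideals_fg_surj (generated_over_nil genf) fgA.
exact: IHxs (ideals_fg_poly fgA) (generated_over_cons genf).
Qed.

End Noetherian.

(** * The dimension of a polynomial ring *)

Section Chains.
Local Open Scope ring_scope.

Definition chain_of_primes (R : comNzRingType) d (q : nat -> R -> Prop) :=
  (forall i, prime_ideal (q i)) /\
  (forall i, (i < d)%N ->
     (forall x, q i x -> q i.+1 x) /\ exists2 x, q i.+1 x & ~ q i x).

Lemma prime_ideal_preim (R S : comNzRingType) (f : {rmorphism R -> S}) P :
  prime_ideal P -> prime_ideal (fun x => P (f x)).
Proof.
case=> iP P1 PM; split.
- by split=> [|a x y Px Py]; rewrite ?rmorph0 ?rmorphD ?rmorphM; [apply: iP.1|apply: iP.2].
- by rewrite rmorph1.
- by move=> x y; rewrite rmorphM; apply: PM.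
Qed.

Lemma chain_of_primes_sub (R : comNzRingType) d (q : nat -> R -> Prop) i x :
  chain_of_primes d q -> (i <= d)%N -> q 0%N x -> q i x.
Proof.
case=> _ qS + q0; elim: i => // i IHi id; apply: (qS i id).1.
by apply: IHi; apply: ltnW.
Qed.

(** Strict inclusions survive the pullback because f is surjective modulo the
smallest prime of the chain. *)
Lemma chain_of_primes_pull (R S : comNzRingType) (f : {rmorphism R -> S}) d
    (q : nat -> S -> Prop) :
  chain_of_primes d q -> (forall y, exists x, q 0%N (y - f x)) ->
  chain_of_primes d (fun i x => q i (f x)).
Proof.
move=> ch fsurj; have [pr qS] := ch; split=> [i|i id]; first exact: prime_ideal_preim.
have [sub [y qy nqy]] := qS i id; split; first by move=> x; apply: sub.
have [x qx] := fsurj y.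
have {}qx j : (j <= d)%N -> q j (y - f x) by move=> jd; apply: (chain_of_primes_sub ch jd qx).
have [iq _ _] := pr i; have [iq' _ _] := pr i.+1; exists x.
  by rewrite -[f x](subKr y); apply: idealB => //; apply: qx.
move=> qfx; apply: nqy; rewrite -[y](subrK (f x)); apply: idealD => //.
by apply: qx; apply: ltnW.
Qed.

Lemma chain_of_primes_shift (R : comNzRingType) d (q : nat -> R -> Prop) :
  chain_of_primes d.+1 q -> chain_of_primes d (fun i => q i.+1).
Proof. by case=> pr qS; split=> [i|i id]; [apply: pr|apply: qS]. Qed.

End Chains.

Section BoxPolynomials.
Local Open Scope ring_scope.
Variables (k : fieldType) (A : comAlgType k) (D : nat).

(** A row vector of length D ^ d is read as a polynomial in d variables with all
exponents below D, one variable being split off at a time; [box_eval] is its value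
at the list xs. *)
Fixpoint box_dim d := if d is d'.+1 then (D * box_dim d')%N else 1%N.

Lemma box_dimE d : box_dim d = (D ^ d)%N.
Proof. by elim: d => //= d ->; rewrite expnS. Qed.

Fixpoint box_eval (xs : seq A) : 'rV[k]_(box_dim (size xs)) -> A :=
  if xs is x :: xs' return 'rV[k]_(box_dim (size xs)) -> A
  then fun v => \sum_(i < D) x ^+ i * box_eval (row i (vec_mx v))
  else fun v => (v 0 0)%:A.

Lemma box_evalD xs : {morph @box_eval xs : u v / u + v}.
Proof.
elim: xs => [|x xs IHxs] u v /=; first by rewrite mxE scalerDl.
rewrite -big_split; apply: eq_bigr => i _ /=.
by rewrite -mulrDr -IHxs !linearD.
Qed.

Lemma box_evalZ xs a v : @box_eval xs (a *: v) = a *: box_eval v.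
Proof.
elim: xs v => [|x xs IHxs] v /=; first by rewrite mxE scalerA.
rewrite scaler_sumr; apply: eq_bigr => i _ /=.
by rewrite !linearZ /= IHxs scalerAr.
Qed.

Lemma box_eval0 xs : @box_eval xs 0 = 0.
Proof. by rewrite -(scale0r 0) box_evalZ scale0r. Qed.

Lemma box_eval_sum xs (I : Type) (r : seq I) (F : I -> 'rV[k]_(box_dim (size xs))) :
  box_eval (\sum_(i <- r) F i) = \sum_(i <- r) box_eval (F i).
Proof. by apply: (big_morph _ (@box_evalD xs) (box_eval0 xs)). Qed.

(** A polynomial relation with respect to xs cannot hold modulo the smallest prime
when each term of xs lies in the next prime of the chain but not in the previous
one.  With x the first term and m the lowest exponent of x that occurs, the
relation is x ^ m times (e + x z), where e is a nonzero polynomial in the remaining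
terms.  As x is not in the first prime, e + x z is, and then e is in the second
prime, where the same argument applies to the shorter list. *)
Lemma box_eval_chain xs (q : nat -> A -> Prop) v :
  chain_of_primes (size xs) q ->
  (forall i, (i < size xs)%N -> q i.+1 xs`_i /\ ~ q i xs`_i) ->
  v != 0 -> ~ q 0%N (@box_eval xs v).
Proof.
elim: xs q v => [|x xs IHxs] q v ch xsq v0 /= qv.
  have [iq q1 _] := ch.1 0%N; case: q1.
  suff -> : 1 = (v 0 0)^-1%:A * (v 0 0)%:A :> A by apply: (idealZ _ iq qv).
  rewrite -scalerAl mul1r scalerA mulVf ?scale1r //.
  apply: contraNneq v0 => v00; apply/eqP/rowP=> i.
  by rewrite ord1 v00 mxE.
pose e i := if insub i is Some j then box_eval (row (j : 'I_D) (vec_mx v)) else 0.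
have eE (i : 'I_D) : e i = box_eval (row i (vec_mx v)) by rewrite /e valK.
have [m0 m0P] : exists i : 'I_D, row i (vec_mx v) != 0.
  apply: contrapT => h; case/eqP: v0; rewrite -[v]vec_mxK.
  suff -> : vec_mx v = 0 by rewrite linear0.
  apply/row_matrixP => i; rewrite row0; apply: contrapT => /eqP ri.
  by apply: h; exists i.
have [m mP mmin] := @arg_minnP _ m0 (fun i => row i (vec_mx v) != 0) val m0P.
have [] := IHxs _ (row m (vec_mx v)) (chain_of_primes_shift ch) _ mP.
  by move=> i; apply: (xsq i.+1).
have [pr qS] := ch; have [qx nqx] := xsq 0%N isT.
have [iq' _ _] := pr 1%N; have [_ _ qM] := pr 0%N.
pose z := \sum_(i < D | (m < i)%N) x ^+ (i - m.+1) * e i.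
have zE : \sum_(i < D) x ^+ i * box_eval (row i (vec_mx v)) = x ^+ m * (e m + x * z).
  rewrite (bigD1 m) //= eE mulrDr; congr (_ + _).
  rewrite (bigID (fun i : 'I_D => (m < i)%N)) /= [X in _ + X]big1 ?addr0; last first.
    move=> i /andP[im]; rewrite -leqNgt => mi.
    have {}mi : (i < m)%N by rewrite ltn_neqAle mi andbT -val_eqE in im *.
    suff /eqP-> : row i (vec_mx v) == 0 by rewrite box_eval0 mulr0.
    by apply: contraTT mi => /mmin; rewrite -leqNgt.
  rewrite mulrA -exprSr mulr_sumr; apply: eq_big => [i|i /andP[_ mi]].
    by rewrite andb_idl // => mi; rewrite -val_eqE gtn_eqF.
  by rewrite mulrA -exprD subnKC // eE.
move: qv; rewrite zE => /qM[/(prime_ideal_exp (pr 0%N))//|/(qS 0%N isT).1].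
move=> h; rewrite -[box_eval _](addrK (x * z)) -eE; apply: idealB => //.
exact: idealZr.
Qed.

End BoxPolynomials.

Section Dimension.
Local Open Scope ring_scope.
Variables (k : fieldType) (n : nat).

Lemma box_eval_msize D B (xs : seq {mpoly k[n]}) v :
  (forall x, x \in xs -> (msize x <= B.+1)%N) ->
  (msize (box_eval (D := D) (xs := xs) v) <= (size xs * (D * B)).+1)%N.
Proof.
have mulP (p q : {mpoly k[n]}) a b :
    (msize p <= a.+1)%N -> (msize q <= b.+1)%N -> (msize (p * q) <= (a + b).+1)%N.
  move=> pa qb; have [->|p0] := eqVneq p 0; first by rewrite mul0r msize0.
  have [->|q0] := eqVneq q 0; first by rewrite mulr0 msize0.
  have aux x y : (x <= a.+1 -> y <= b.+1 -> (x + y).-1 <= (a + b).+1)%N by lia.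
  by rewrite msizeM //; apply: aux.
elim: xs v => [|x xs IHxs] v xsB /=.
  apply: leq_trans (msizeZ_le _ _) _; by rewrite msize1.
elim/big_ind: _ => [|p q pB qB|i _]; first by rewrite msize0.
  by apply: leq_trans (mmeasureD_le _ _ _) _; rewrite geq_max pB.
rewrite mulSn; apply: (mulP); last first.
  by apply: IHxs => y yxs; apply: xsB; rewrite inE yxs orbT.
have xB : (msize x <= B.+1)%N by apply: xsB; rewrite mem_head.
have iD : (i <= D)%N by apply: ltnW.
suff: (msize (x ^+ i) <= (i * B).+1)%N.
  by move/leq_trans; apply; rewrite ltnS leq_mul2r iD orbT.
elim: (nat_of_ord i) => [|j IHj]; first by rewrite msize1.
by rewrite exprS mulSn; apply: mulP.
Qed.

(** Counting: the D ^ (n + 1) monomials in xs with exponents below D have degree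
less than E = O(D), hence lie in a space spanned by E ^ n monomials, and
D ^ (n + 1) exceeds E ^ n for D large. *)
Lemma algebraically_dependent (xs : seq {mpoly k[n]}) : size xs = n.+1 ->
  exists D (v : 'rV[k]_(box_dim D (size xs))), v != 0 /\ box_eval (xs := xs) v = 0.
Proof.
move=> sxs; pose B := (\max_(x <- xs) msize x)%N.
(* E <= C * D, so E ^ n <= C ^ n * D ^ n < D ^ (n + 1). *)
pose C := (n.+1 * B).+2; pose D := (C ^ n).+1; exists D.
pose E := (n.+1 * (D * B)).+1.
have sizeB v : (msize (box_eval (D := D) (xs := xs) v) <= E)%N.
  rewrite /E -sxs; apply: box_eval_msize => x xxs; apply: leqW.
  exact: (@leq_bigmax_seq _ xs xpredT (fun x => msize x)).
pose mon (j : 'I_#|{ffun 'I_n -> 'I_E}|) := [multinom (enum_val j i : nat) | i < n].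
pose L := \matrix_(i < box_dim D (size xs), j < #|{ffun 'I_n -> 'I_E}|)
  (box_eval (D := D) (xs := xs) (delta_mx 0 i))@_(mon j).
have : kermx L != 0.
  rewrite -mxrank_eq0 mxrank_ker subn_eq0 -ltnNge.
  apply: leq_ltn_trans (rank_leq_col _) _.
  rewrite card_ffun !card_ord box_dimE sxs.
  have EC : (E <= D * C)%N by rewrite /E /C; lia.
  apply: (@leq_ltn_trans ((D * C) ^ n)%N).
    by have [->//|n0] := posnP n; rewrite leq_exp2r.
  by rewrite expnMn expnSr ltn_pmul2l ?expn_gt0.
case/rowV0Pn => v /sub_kermxP vL v0; exists v; split=> //.
apply/mpolyP => m; rewrite mcoeff0.
have [mE|] := boolP [forall i, (m i < E)%N]; last first.
  case/forallPn => i; rewrite -leqNgt => Em; apply/eqP.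
  rewrite mcoeff_eq0; apply: msize_mdeg_ge; apply: leq_trans (sizeB v) _.
  by apply: leq_trans Em _; rewrite mdegE (bigD1 i) //= leq_addr.
pose j := enum_rank [ffun i => (inord (m i) : 'I_E)].
have mj : mon j = m.
  apply/mnmP => i; rewrite mnmE enum_rankK ffunE inordK //.
  by move/forallP: mE.
transitivity ((v *m L) 0 j); last by rewrite vL mxE.
rewrite mxE {1}[v]row_sum_delta box_eval_sum raddf_sum /=.
by apply: eq_bigr => i _; rewrite box_evalZ mcoeffZ !mxE mj.
Qed.

Lemma chain_of_primes_mpoly d (q : nat -> {mpoly k[n]} -> Prop) :
  chain_of_primes d q -> (d <= n)%N.
Proof.
move=> [pr qS]; rewrite leqNgt; apply/negP => nd.
have ch : chain_of_primes n.+1 q.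
  by split=> // i ilt; apply: qS; apply: leq_trans nd.
have /choice[x xP] (i : nat) : exists x, (i < n.+1)%N -> q i.+1 x /\ ~ q i x.
  have [/ch.2[_ [x qx nqx]]|_] := boolP (i < n.+1)%N; last by exists 0.
  by exists x.
have sxs : size (mkseq x n.+1) = n.+1 by rewrite size_mkseq.
have [D [v [v0 ev]]] := algebraically_dependent sxs.
have [] := @box_eval_chain _ _ D (mkseq x n.+1) q v _ _ v0.
- by rewrite sxs.
- by move=> i; rewrite sxs => ilt; rewrite nth_mkseq //; apply: xP.
- by rewrite ev; have [[]] := pr 0%N.
Qed.

End Dimension.

(** * Zariski's lemma *)

Section Zariski.
Local Open Scope ring_scope.
Variable K : idomainType.

(** The image of A in K becomes a field after inverting the single element b
(Kaplansky's G-domains).  A field has this property, and it descends from A[X] to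
A; on the way the image of X is found to be algebraic over A.  Since f need not be
injective, no fraction fields or subrings have to be formed. *)
Definition g_domain (A : comNzRingType) (f : A -> K) :=
  exists2 b, f b != 0 &
    forall c, f c != 0 -> exists m c', f (c * c') = f b ^+ m.

Section Step.
Variables (A : comNzRingType) (f : {rmorphism {poly A} -> K}).

Local Notation j := (f \o polyC).
Local Notation x := (f 'X).

Lemma adjoin_eval p : f p = (map_poly j p).[x].
Proof.
elim/poly_ind: p => [|p c IHp]; first by rewrite !rmorph0 horner0.
by rewrite !rmorphD !rmorphM /= IHp map_polyX map_polyC /= hornerD hornerMX hornerC.
Qed.

(** If X were transcendental, 1 + X b would divide a power of b in K[X], although
it is coprime to b and not constant. *)
Lemma g_domain_algebraic : g_domain f ->
  exists2 p, f p = 0 & map_poly j p != 0.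
Proof.
case=> b fb0 gb; apply: contrapT => trans.
have inj p : f p = 0 -> map_poly j p = 0.
  by move=> fp; apply: contrapT => /eqP p0; apply: trans; exists p.
pose B := map_poly j b; pose C := 1 + 'X * B.
have B0 : B != 0 by apply: contraNneq fb0 => b0; rewrite adjoin_eval -/B b0 horner0.
have sC : (1 < size C)%N.
  have sXB : size ('X * B) = (size B).+1 by rewrite mulrC size_mulX.
  by rewrite /C addrC size_polyDl sXB ?size_poly1 ltnS size_poly_gt0.
have CE : map_poly j (1 + 'X * b) = C by rewrite rmorphD rmorphM /= rmorph1 map_polyX.
have C0 : C != 0 by rewrite -size_poly_gt0 (ltn_trans _ sC).
have [|m [c' fc]] := gb (1 + 'X * b).
  by apply: contraNneq C0 => /inj; rewrite CE => ->.
have /inj : f ((1 + 'X * b) * c' - b ^+ m) = 0 by rewrite rmorphB fc rmorphXn subrr.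
rewrite rmorphB rmorphM rmorphXn /= CE -/B => /eqP; rewrite subr_eq0 => /eqP CB.
have [W WE] : exists W, (C - 1) ^+ m = C * W + (-1) ^+ m.
  elim: m {fc CB} => [|m [W WE]]; first by exists 0; rewrite mulr0 add0r.
  by exists (C * W + (-1) ^+ m - W); rewrite !exprS WE; ring.
have : C * ('X^m * map_poly j c' - W) = (-1) ^+ m.
  by rewrite mulrBr mulrCA CB -exprMn (_ : 'X * B = C - 1) ?WE /C; ring.
move=> /(congr1 (fun p : {poly K} => size p)).
have -> : (-1) ^+ m = ((-1) ^+ m)%:P :> {poly K} by rewrite rmorphXn rmorphN rmorph1.
rewrite size_polyC signr_eq0 /=.
have [->|Y0] := eqVneq ('X^m * map_poly j c' - W) 0; first by rewrite mulr0 size_poly0.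
move: Y0; set Y := 'X^m * _ - W => Y0; rewrite size_mul //.
move: Y0; rewrite -size_poly_gt0; case: (size C) sC => [|[|u]] // _.
by case: (size Y) => // v _; rewrite addnS.
Qed.

Section Algebraic.
Variables (p : {poly A}) (s : nat).
Hypotheses (fp : f p = 0) (sp : (size p <= s.+1)%N) (ps : j p`_s != 0).
Let e := p`_s.

Lemma degree_gt0 : (0 < s)%N.
Proof.
move: fp sp ps; case: s => // fp0 sp1.
by rewrite (size1_polyC sp1) in fp0 *; rewrite coefC /= fp0 eqxx.
Qed.

(** Pseudo-division by p: each multiplication by the leading coefficient e lowers
the degree by one. *)
Lemma reduce_degree t (u : {poly A}) : (size u <= s + t)%N ->
  exists2 r : {poly A}, (size r <= s)%N & f (e%:P ^+ t * u) = f r.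
Proof.
elim: t u => [|t IHt] u su; first by exists u; rewrite ?mul1r // -[s]addn0.
have [|r sr fr] := IHt (e%:P * u - u`_(s + t) *: 'X^t * p).
  apply/leq_sizeP => i; rewrite leq_eqVlt => /predU1P[<-|si].
    rewrite coefB coefCM -scalerAl coefZ coefXnM ltnNge leq_addl /= addnK.
    by rewrite -/e mulrC subrr.
  rewrite coefB coefCM -scalerAl coefZ coefXnM.
  rewrite (nth_default _ (leq_trans su _)) ?addnS // mulr0.
  have -> : (i < t)%N = false by apply/negbTE; rewrite -leqNgt (leq_trans (leq_addl s t)) // ltnW.
  rewrite [p`_ _]nth_default ?mulr0 ?subr0 // (leq_trans sp) //.
  by rewrite ltn_subRL addnC.
exists r => //; rewrite -fr exprSr -mulrA mulrBr rmorphB /= [X in _ - X]rmorphM.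
by rewrite [f (_ * p)]rmorphM fp !mulr0 subr0.
Qed.

(** After multiplication by a power of e, the element h acts on the span of
1, x, ..., x ^ (s - 1) by a matrix M over A, because of [reduce_degree]; so it is a
root of the characteristic polynomial of M, by the adjugate identity applied to the
vector of powers of x. *)
Lemma scaled_integral h : exists t (chi : {poly A}),
  chi \is monic /\ (map_poly j chi).[f (e%:P ^+ t * h)] = 0.
Proof.
pose t := size h; exists t; pose beta := f (e%:P ^+ t * h).
have /fin_all_exists2[r sr fr] (i : 'I_s) :
    exists2 r : {poly A}, (size r <= s)%N & f (e%:P ^+ t * ('X^i * h)) = f r.
  apply: reduce_degree; rewrite (leq_trans (size_polyMleq _ _)) // size_polyXn /=.
  by rewrite leq_add2r ltnW.
pose M := \matrix_(i < s, l < s) (r i)`_l.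
exists (char_poly M); split; first exact: char_poly_monic.
rewrite map_char_poly -/beta.
pose N := beta%:M - map_mx j M; pose v : 'cV[K]_s := \col_i x ^+ i.
have -> : (char_poly (map_mx j M)).[beta] = \det N.
  rewrite /char_poly -horner_evalE -det_map_mx; congr (\det _).
  apply/matrixP => a b; rewrite !mxE /= /horner_eval.
  by rewrite hornerD hornerN hornerC hornerMn hornerX.
have Nv : N *m v = 0.
  rewrite mulmxBl mul_scalar_mx; apply/eqP; rewrite subr_eq0; apply/eqP/colP => i.
  rewrite !mxE; transitivity (f (r i)).
    by rewrite -fr mulrCA [f (_ * (_ * _))]rmorphM rmorphXn mulrC.
  rewrite adjoin_eval (@horner_coef_wide _ s); last first.
    exact: leq_trans (size_poly _ _) (sr i).
  by apply: eq_bigr => l _; rewrite !mxE coef_map.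
have s0 := degree_gt0.
have /(congr1 (fun w : 'cV[K]_s => w (Ordinal s0) 0)) : \adj N *m N *m v = 0.
  by rewrite -mulmxA Nv mulmx0.
by rewrite mul_adj_mx mul_scalar_mx !mxE /= mulr1.
Qed.

(** A relation of integral dependence with its powers of h cancelled has a nonzero
constant term, which is then a multiple of h. *)
Lemma divides_constant h : f h != 0 ->
  exists a w, j a != 0 /\ j a = f (h * w).
Proof.
move=> fh0; have [t [chi [chi1 root_chi]]] := scaled_integral h.
set u := _ * h in root_chi.
have fu0 : f u != 0 by rewrite rmorphM rmorphXn mulf_neq0 ?expf_neq0.
have [q jq qmin] : exists2 q, j chi`_q != 0 & forall i, (i < q)%N -> j chi`_i = 0.
  have exq : exists q, j chi`_q != 0.
    by exists (size chi).-1; rewrite -lead_coefE (monicP chi1) /= rmorph1 oner_eq0.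
  exists (ex_minn exq); first by case: ex_minnP.
  case: ex_minnP => q _ qmin i iq; apply: contraTeq iq => /qmin.
  by rewrite -leqNgt.
pose chi' := drop_poly q chi; pose g := drop_poly 1 chi'.
have root' : (map_poly j chi').[f u] = 0.
  have : (map_poly j chi').[f u] * f u ^+ q = 0.
    rewrite -root_chi -[in RHS](poly_take_drop q chi) rmorphD rmorphM /=.
    rewrite map_polyXn hornerD hornerM hornerXn.
    suff -> : map_poly j (take_poly q chi) = 0 by rewrite horner0 add0r.
    apply/polyP => i; rewrite coef_map coef_take_poly coef0.
    by case: ifP => [/qmin|_]; last exact: rmorph0.
  by move/eqP; rewrite mulf_eq0 (negPf (expf_neq0 _ fu0)) orbF => /eqP.
have chi'E : chi' = g * 'X + (chi`_q)%:P.
  apply/polyP => i; rewrite /g /chi' coefD coefMX coefC !coef_drop_poly.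
  by case: i => [|i] /=; rewrite ?add0r // addr0 addn1.
exists chi`_q, (- (e%:P ^+ t * (map_poly polyC g).[u])); split=> //.
have -> : h * - (e%:P ^+ t * (map_poly polyC g).[u]) = - ((map_poly polyC g).[u] * u).
  by rewrite /u; ring.
rewrite rmorphN rmorphM /=.
have -> : f (map_poly polyC g).[u] = (map_poly j g).[f u].
  by rewrite -horner_map map_poly_comp.
move: root'; rewrite chi'E rmorphD rmorphM /= map_polyX map_polyC /=.
by rewrite hornerD hornerMX hornerC => /eqP; rewrite addrC addr_eq0 => /eqP.
Qed.

End Algebraic.

(** Let c in A be nonzero in K.  It divides a power of b in A[x], hence also a power
of the constant a0 that is a multiple of b.  The cofactor z satisfies a monic
equation after scaling by a power of e; multiplying that equation by a power of c
turns it into the statement that c divides a power of e * a0 within A. *)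
Lemma g_domain_coef : g_domain f -> g_domain (fun a : A => f a%:P).
Proof.
move=> gf; have [p0 fp0 p00] := g_domain_algebraic gf.
pose s := (size (map_poly j p0)).-1.
have sE : size (map_poly j p0) = s.+1 by rewrite prednK // size_poly_gt0.
(* Only coefficients that vanish in K are dropped, so that the leading coefficient
of p does not. *)
pose p := take_poly s.+1 p0.
have pE : map_poly j p = map_poly j p0.
  apply/polyP => i; rewrite !coef_map coef_take_poly; case: ltnP => // si.
  by rewrite -coef_map [RHS]nth_default ?sE //; apply: rmorph0.
have fp : f p = 0 by rewrite adjoin_eval pE -adjoin_eval.
have sp : (size p <= s.+1)%N by apply: size_take_poly.
have ps : j p`_s != 0.
  by rewrite -coef_map pE -[s]/(s.+1.-1) -sE -lead_coefE lead_coef_eq0.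
have [b fb0 gb] := gf.
have [a0 [w [ja0 a0E]]] := divides_constant fp sp ps fb0.
exists (p`_s * a0); first by rewrite rmorphM /= rmorphM mulf_neq0.
move=> c fc0; have [m [c' fc]] := gb _ fc0.
have [t [chi [chi1 root_chi]]] := scaled_integral fp sp ps (c' * w ^+ m).
pose y := p`_s ^+ t * a0 ^+ m; pose d := (size chi).-1.
have dE : size chi = d.+1 by rewrite prednK // size_poly_gt0 monic_neq0.
set Z := f _ in root_chi; have yE : f c%:P * Z = f y%:P.
  have cz : f (c%:P * (c' * w ^+ m)) = f a0%:P ^+ m.
    by rewrite mulrA rmorphM fc rmorphXn -exprMn -rmorphM -a0E.
  have -> : f y%:P = f ((p`_s)%:P ^+ t) * f a0%:P ^+ m.
    by rewrite /y -[f a0%:P ^+ m]rmorphXn -rmorphM polyCM !rmorphXn.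
  by rewrite -cz /Z -!rmorphM mulrCA.
have yDef : y = p`_s ^+ t * a0 ^+ m by [].
clearbody Z y.
pose S := \sum_(i < d) chi`_i * y ^+ i * c ^+ (d.-1 - i).
have root_y : j y ^+ d = - (j c * j S).
  apply/eqP; rewrite -addr_eq0; apply/eqP.
  move/(congr1 (fun v => v * j c ^+ d)): root_chi.
  rewrite mul0r (@horner_coef_wide _ d.+1); last first.
    by rewrite -dE size_poly.
  move=> <-; rewrite big_ord_recr /= coef_map -[X in chi`_X]/(d.+1.-1) -dE.
  rewrite -lead_coefE (monicP chi1) /= rmorph1 mul1r mulrDl addrC; congr (_ + _).
    rewrite [f S%:P](rmorph_sum j) mulr_sumr mulr_suml; apply: eq_bigr => i _ /=.
    have -> : f c%:P ^+ d = f c%:P ^+ i * (f c%:P * f c%:P ^+ (d.-1 - i)).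
      by rewrite -exprS -exprD; congr (_ ^+ _); have := ltn_ord i; lia.
    rewrite coef_map !(rmorphM, rmorphXn) /= ?(rmorphM, rmorphXn) /= -yE exprMn.
    by ring.
  by rewrite -exprMn mulrC yE.
exists ((t + m) * d)%N, (- (S * (p`_s ^+ m * a0 ^+ t) ^+ d)).
have powE : (p`_s * a0) ^+ ((t + m) * d) = y ^+ d * (p`_s ^+ m * a0 ^+ t) ^+ d.
  by rewrite exprM -exprMn yDef; congr (_ ^+ d); rewrite exprMn !exprD; ring.
rewrite -[RHS]rmorphXn -[(_)%:P ^+ _]rmorphXn powE /= !polyCM [RHS]rmorphM.
have -> : f (y ^+ d)%:P = - f (c * S)%:P.
  by rewrite polyC_exp rmorphXn root_y /= -rmorphM -polyCM.
rewrite mulNr -polyCM -[f (c * S)%:P * _]rmorphM -polyCM -raddfN -polyCN.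
by congr (f _%:P); ring.
Qed.

End Step.

Lemma g_domain_base (A : comNzRingType) (f : {rmorphism A -> K}) xs :
  g_domain (@id K) -> generated_over f xs -> g_domain f.
Proof.
move=> gK; elim: xs A f => [|x xs IHxs] A f genf.
  have fsurj := generated_over_nil genf; case: gK => b b0 gb.
  have [b' b'E] := fsurj b; exists b'; first by rewrite b'E.
  move=> c /gb[m [c' cc']]; have [c'' c''E] := fsurj c'.
  by exists m, c''; rewrite rmorphM c''E b'E cc'.
have /g_domain_coef[b b0 gb] := IHxs _ _ (generated_over_cons genf).
exists b => [|c]; first by rewrite -(adjoinC f x).
rewrite -(adjoinC f x) => /gb[m [c' cc']]; exists m, c'.
by rewrite -!(adjoinC f x).
Qed.

End Zariski.

Section ZariskiLemma.
Local Open Scope ring_scope.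

(** The property of [g_domain] descends from K through the generators xs to k[X],
with X mapped to y, and there it forces y to be algebraic. *)
Lemma zariski (K : idomainType) (k : fieldType) (f : {rmorphism k -> K}) xs y :
  (forall z : K, z != 0 -> exists z', z * z' = 1) ->
  generated_over f xs -> exists2 p, p != 0 & root (map_poly f p) y.
Proof.
move=> fieldK genf.
have gK : g_domain (@id K).
  exists 1; first exact: oner_neq0.
  by move=> c /fieldK[c' cc']; exists 0%N, c'.
have : generated_over (adjoin f y) xs.
  by apply: generated_over_cons => B Bf Bxs; apply: genf => // x xxs; apply: Bxs; rewrite inE xxs orbT.
move/(g_domain_base gK)/g_domain_algebraic => [p fp p0].
have pE : map_poly (adjoin f y \o polyC) p = map_poly f p.
  by apply: eq_map_poly => a; apply: adjoinC.
exists p; last first.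
  by have := adjoin_eval (adjoin f y) p; rewrite fp adjoinX pE /root => <-.
by apply: contraNneq p0 => ->; rewrite rmorph0.
Qed.

End ZariskiLemma.

(** * Regular sequences modulo Stanley-Reisner ideals *)

Lemma pred_ext (T : Type) (P Q : T -> Prop) : (forall x, P x <-> Q x) -> P = Q.
Proof. by move=> PQ; apply/funext => x; apply/propext. Qed.

Section WeaklyRegular.
Local Open Scope ring_scope.
Variable R : comNzRingType.
Implicit Types (J : R -> Prop) (x y z g : R) (gs : seq R).

(** The ideal J + (g). *)
Definition add_gen J g : R -> Prop := fun x => exists2 j, J j & exists z, x = j + z * g.

Definition colon J x : R -> Prop := fun y => J (y * x).

(** As for a regular sequence on R/J, but R/J modulo the sequence may vanish; that
is what makes the property inductive along the exact sequences below. *)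
Fixpoint weakly_regular J gs : Prop :=
  if gs is g :: gs' then (forall y, J (y * g) -> J y) /\ weakly_regular (add_gen J g) gs'
  else True.

Lemma ideal_add_gen J g : ideal J -> ideal (add_gen J g).
Proof.
move=> [J0 JD]; split; first by exists 0 => //; exists 0; rewrite mul0r addr0.
move=> a _ _ [u Ju [z ->]] [v Jv [w ->]]; exists (a * u + v); first exact: JD.
by exists (a * z + w); ring.
Qed.

Lemma sub_add_gen J g x : J x -> add_gen J g x.
Proof. by exists x => //; exists 0; rewrite mul0r addr0. Qed.

Lemma mem_add_gen J g : ideal J -> add_gen J g g.
Proof. by move=> iJ; exists 0; [apply: ideal0|exists 1; rewrite add0r mul1r]. Qed.

Lemma add_gen_min J J' g x :
  ideal J' -> (forall y, J y -> J' y) -> J' g -> add_gen J g x -> J' x.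
Proof.
by move=> iJ' JJ' J'g [j /JJ' Jj [z ->]]; apply: idealD => //; apply: idealZ.
Qed.

Lemma add_gen_swap J g h x : ideal J ->
  add_gen (add_gen J g) h x -> add_gen (add_gen J h) g x.
Proof.
move=> iJ; have ih := ideal_add_gen h iJ; have igh := ideal_add_gen g ih.
apply: add_gen_min => // [y|]; last by apply: sub_add_gen; apply: mem_add_gen.
apply: add_gen_min => // [z Jz|]; first by do 2 apply: sub_add_gen.
exact: mem_add_gen.
Qed.

Lemma add_genC J g h : ideal J -> add_gen (add_gen J g) h = add_gen (add_gen J h) g.
Proof. by move=> iJ; apply: pred_ext => x; split; apply: add_gen_swap. Qed.

(** Cutting 0 -> R/(J : x) -> R/J -> R/(J + x) -> 0 by g keeps it exact, as g is
regular on the right-hand term. *)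
Lemma colon_add_gen J x g : ideal J ->
  (forall y, add_gen J x (y * g) -> add_gen J x y) ->
  colon (add_gen J g) x = add_gen (colon J x) g.
Proof.
move=> iJ regg; apply: pred_ext => z; split=> [[j Jj [y zxE]]|[u Ju [y ->]]].
  have [|j' Jj' [w yE]] := regg y.
    exists (- j); first exact: idealN.
    by exists z; rewrite zxE; ring.
  exists (z - w * g); last by exists w; ring.
  rewrite /colon mulrBl zxE yE.
  have -> : j + (j' + w * x) * g - w * g * x = g * j' + j by ring.
  exact: iJ.2.
by exists (u * x) => //; exists (y * x); ring.
Qed.

(** An element that is regular on both ends of
0 -> R/(J : x) -> R/J -> R/(J + x) -> 0 is regular in the middle, and the three
quotients by it form an exact sequence of the same kind. *)
Lemma weakly_regular_extension J x gs : ideal J ->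
  weakly_regular (colon J x) gs -> weakly_regular (add_gen J x) gs ->
  weakly_regular J gs.
Proof.
elim: gs J => //= g gs IHgs J iJ [cg cgs] [ag ags]; split.
  move=> y Jyg; have [|j Jj [z yE]] := ag y; first exact: sub_add_gen.
  have Jz : colon J x z.
    apply: cg; rewrite /colon.
    have -> : z * g * x = y * g - g * j by rewrite yE; ring.
    by apply: idealB => //; apply: idealZ.
  by rewrite yE; apply: idealD.
apply: IHgs; first exact: ideal_add_gen.
  by rewrite colon_add_gen.
by rewrite add_genC.
Qed.

Lemma add_gen_congr J g h : ideal J -> J (g - h) -> add_gen J g = add_gen J h.
Proof.
move=> iJ Jgh; apply: pred_ext => x; split=> [[j Jj [z ->]]|[j Jj [z ->]]].
  exists (z * (g - h) + j); first exact: iJ.2.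
  by exists z; ring.
exists (- z * (g - h) + j); first exact: iJ.2.
by exists z; ring.
Qed.

Lemma weakly_regular_congr J (I : eqType) (s : seq I) (g h : I -> R) : ideal J ->
  (forall i, i \in s -> J (g i - h i)) ->
  weakly_regular J (map h s) -> weakly_regular J (map g s).
Proof.
elim: s J => //= i s IHs J iJ gh [hi hs].
have Ji : J (g i - h i) by apply: gh; rewrite mem_head.
split=> [y Jy|].
  apply: hi; have -> : y * h i = y * g i - y * (g i - h i) by ring.
  by apply: idealB => //; apply: idealZ.
rewrite (add_gen_congr iJ Ji); apply: IHs => //; first exact: ideal_add_gen.
by move=> l ls; apply: sub_add_gen; apply: gh; rewrite inE ls orbT.
Qed.

Lemma ideal_horner J (f : {poly R}) a b : ideal J -> J (a - b) -> J (f.[a] - f.[b]).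
Proof.
move=> iJ Jab; elim/poly_ind: f => [|f c IHf]; first by rewrite !horner0 subrr; apply: ideal0.
rewrite !hornerD !hornerM !hornerX !hornerC.
have -> : f.[a] * a + c - (f.[b] * b + c) = a * (f.[a] - f.[b]) + f.[b] * (a - b) by ring.
by apply: idealD => //; apply: idealZ.
Qed.

(** The extension J[X] of J to the polynomial ring. *)
Definition poly_ideal J (p : {poly R}) := forall i, J p`_i.

Lemma ideal_poly_ideal J : ideal J -> ideal (poly_ideal J).
Proof.
move=> iJ; split=> [i|a p q Jp Jq i]; first by rewrite coef0; apply: ideal0.
rewrite coefD coefM; apply: idealD => //.
by apply: ideal_sum => // l _; apply: idealZ.
Qed.

Lemma poly_idealC J c : ideal J -> J c -> poly_ideal J c%:P.
Proof. by move=> iJ Jc i; rewrite coefC; case: eqP => // _; apply: ideal0. Qed.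

(** Compare coefficients from the top: if those of p above i lie in J, then the
coefficient of degree i + deg f of p * f is, modulo J, that of p in degree i times
the leading coefficient of f. *)
Lemma poly_ideal_regular J (p f : {poly R}) u : ideal J -> u * lead_coef f = 1 ->
  poly_ideal J (p * f) -> poly_ideal J p.
Proof.
move=> iJ uf Jpf.
have f0 : f != 0.
  by apply: contra_eq_neq uf => ->; rewrite lead_coef0 mulr0 eq_sym oner_neq0.
pose d := (size f).-1; have dE : size f = d.+1 by rewrite prednK // size_poly_gt0.
suff H n i : (size p - n <= i)%N -> J p`_i by move=> i; apply: (H (size p)); rewrite subnn.
elim: n i => [|n IHn] i; first by rewrite subn0 => pi; rewrite nth_default //; apply: ideal0.
move=> ni; have [/IHn//|ilt] := leqP (size p - n) i.
have := Jpf (i + d)%N; rewrite coefM.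
have id : (i < (i + d).+1)%N by rewrite ltnS leq_addr.
rewrite (bigD1 (Ordinal id)) //= addKn -[f`_d]/(lead_coef f).
set r := \sum_(_ | _) _.
move=> Jr.
have rJ : J r.
  apply: ideal_sum => // l; rewrite -val_eqE /= => li.
  have [il|li'] := ltnP i l; last first.
    have {}li' : (l < i)%N by rewrite ltn_neqAle li.
    rewrite [f`_ _]nth_default ?mulr0; first exact: ideal0.
    by rewrite dE -addnBAC ?(ltnW li') // -addn1 addnC leq_add2r subn_gt0.
  by apply: idealZr => //; apply: IHn; lia.
have -> : p`_i = u * (p`_i * lead_coef f + r) - u * r by rewrite -[LHS]mulr1 -uf; ring.
by apply: idealB => //; apply: idealZ.
Qed.

End WeaklyRegular.

Section StanleyReisner.
Local Open Scope ring_scope.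
Variables (k : fieldType) (V : finType).
Local Notation S := {mpoly k[#|V|]}.
Local Notation X := (vertex_var k).
Local Notation C := (@mpolyC #|V| k).
Implicit Types (D : {set V} -> bool) (p q : S) (v : V) (F : {set V}).

(** The set of vertices whose variables occur in the monomial m. *)
Definition msuppv (m : 'X_{1..#|V|}) : {set V} := [set v | m (enum_rank v) != 0%N].

Definition down_closed D := forall A B : {set V}, A \subset B -> D B -> D A.

(** The ideal spanned by the monomials whose support is not a face of D. *)
Definition stanley_reisner D : S -> Prop :=
  fun p => forall m, m \in msupp p -> ~~ D (msuppv m).

Lemma msuppvD m1 m2 : msuppv (m1 + m2)%MM = msuppv m1 :|: msuppv m2.
Proof. by apply/setP => v; rewrite !inE mnmDE addn_eq0 negb_and. Qed.

Lemma msuppvU v : msuppv U_(enum_rank v)%MM = [set v].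
Proof.
apply/setP => u; rewrite !inE mnm1E (inj_eq enum_rank_inj) [u == v]eq_sym.
by case: (v == u).
Qed.

Lemma ideal_stanley_reisner D : down_closed D -> ideal (stanley_reisner D).
Proof.
move=> dD; split=> [m|a p q Jp Jq m]; first by rewrite msupp0.
move/msuppD_le; rewrite mem_cat => /orP[/msuppM_le/allpairsP[[m1 m2] /= [_ /Jp Dm2 ->]]|/Jq//].
by apply: contra Dm2; apply: dD; rewrite msuppvD subsetUr.
Qed.

Lemma stanley_reisner_mon D c m : ~~ D (msuppv m) -> stanley_reisner D (c *: 'X_[m]).
Proof.
move=> Dm m' /msuppZ_le; rewrite msuppX inE => /eqP->.
exact: Dm.
Qed.

(** The star of v. *)
Lemma colon_stanley_reisner D v :
  colon (stanley_reisner D) (X v) = stanley_reisner (fun A => D (v |: A)).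
Proof.
apply: pred_ext => p; rewrite /colon /stanley_reisner /vertex_var.
have E m : m \in msupp (p * 'X_(enum_rank v)) ->
    exists2 m', m' \in msupp p & msuppv m = v |: msuppv m'.
  rewrite (perm_mem (msuppMX _ _)) => /mapP[m' m'p ->]; exists m' => //.
  by rewrite msuppvD msuppvU.
split=> Jp m mp; last by have [m' /Jp Dm' ->] := E m mp.
have := Jp (U_(enum_rank v) + m)%MM; rewrite (perm_mem (msuppMX _ _)) msuppvD msuppvU.
by apply; apply: map_f.
Qed.

(** The deletion of v. *)
Lemma add_gen_stanley_reisner D v : down_closed D ->
  add_gen (stanley_reisner D) (X v) = stanley_reisner (fun A => D A && (v \notin A)).
Proof.
move=> dD; have iD := ideal_stanley_reisner dD.
apply: pred_ext => p; split=> [[j Jj [z ->]] m|Jp].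
  move/msuppD_le; rewrite mem_cat => /orP[/Jj/negPf->//|].
  rewrite /vertex_var (perm_mem (msuppMX _ _)) => /mapP[m' _ ->].
  by rewrite msuppvD msuppvU !inE eqxx andbF.
rewrite [p]mpolyE (bigID (fun m => v \in msuppv m)) /= addrC.
set j := \sum_(_ <- _ | _) _; exists j.
  rewrite /j big_seq_cond; apply: ideal_sum => // m /andP[mp vm].
  apply: stanley_reisner_mon; apply: contra (Jp m mp) => Dm.
  by rewrite Dm.
exists (\sum_(m <- msupp p | v \in msuppv m) p@_m *: 'X_[m - U_(enum_rank v)]).
congr (_ + _); rewrite mulr_suml; apply: eq_bigr => m vm.
rewrite -scalerAl -mpolyXD submK //; apply/mnm_lepP => i.
rewrite mnm1E; case: eqP => // <-.
by move: vm; rewrite inE lt0n.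
Qed.

Section Simplex.

(** S viewed as a ring of polynomials in the variable of v, with coefficients again
in S. *)
Definition as_poly v : {rmorphism S -> {poly S}} :=
  mmap (polyC \o C) (fun i => if i == enum_rank v then 'X else ('X_i)%:P).

Lemma as_polyX v : as_poly v (X v) = 'X.
Proof. by rewrite /as_poly /vertex_var /= mmapX mmap1U eqxx. Qed.

Lemma as_polyXn v u : u != v -> as_poly v (X u) = (X u)%:P.
Proof.
move=> uv; rewrite /as_poly /vertex_var /= mmapX mmap1U (inj_eq enum_rank_inj).
by rewrite (negPf uv).
Qed.

Lemma as_polyC v c : as_poly v c%:MP = c%:MP%:P.
Proof. by rewrite /as_poly /= mmapC. Qed.

Lemma as_polyK v p : (as_poly v p).[X v] = p.
Proof.
elim/mpolyind: p => [|c m p _ _ IHp]; first by rewrite rmorph0 horner0.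
rewrite rmorphD hornerD; congr (_ + _); last exact: IHp.
rewrite -mul_mpolyC rmorphM /= hornerM as_polyC hornerC; congr (_ * _).
rewrite mpolyXE_id rmorph_prod /= horner_prod; apply: eq_bigr => i _.
rewrite rmorphXn /= horner_exp; congr (_ ^+ _).
rewrite -[i]enum_valK; have [->|iv] := eqVneq (enum_val i) v.
  by rewrite as_polyX hornerX.
by rewrite as_polyXn // hornerC.
Qed.

(** For an ideal J: it is generated by polynomials in which the variable of v does not
occur. *)
Definition free_of v (J : S -> Prop) := forall p, J p -> poly_ideal J (as_poly v p).

Definition eval_at (f : {poly k}) (x : S) : S := (map_poly C f).[x].

Lemma as_poly_eval_at v f x :
  as_poly v (eval_at f x) = (map_poly (polyC \o C) f).[as_poly v x].
Proof.
rewrite /eval_at; elim/poly_ind: f => [|f c IHf]; first by rewrite !rmorph0 !horner0 rmorph0.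
rewrite [map_poly (@mpolyC _ _) _]rmorphD [map_poly (_ \o _) _]rmorphD !rmorphM /=.
rewrite !map_polyX !map_polyC /= !hornerD !hornerMX !hornerC rmorphD rmorphM IHf.
by rewrite as_polyC.
Qed.

Lemma as_poly_eval_atX v f : as_poly v (eval_at f (X v)) = map_poly C f.
Proof.
rewrite as_poly_eval_at as_polyX map_poly_comp.
by rewrite -[RHS]comp_polyXr /comp_poly.
Qed.

Lemma as_poly_eval_atXn v u f : u != v ->
  as_poly v (eval_at f (X u)) = (eval_at f (X u))%:P.
Proof. by move=> uv; rewrite as_poly_eval_at as_polyXn // map_poly_comp horner_map. Qed.

(** As a polynomial in the variable of v, f has an invertible leading coefficient,
and membership in J can be tested on coefficients. *)
Lemma free_of_regular v J f : ideal J -> free_of v J -> f != 0 ->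
  forall y, J (y * eval_at f (X v)) -> J y.
Proof.
move=> iJ vJ f0 y /vJ; rewrite rmorphM /= as_poly_eval_atX => Jyf.
have lf : (lead_coef f)^-1%:MP * lead_coef (map_poly C f) = 1.
  rewrite lead_coef_map.
  by rewrite -rmorphM mulVf ?lead_coef_eq0.
have Jy := poly_ideal_regular iJ lf Jyf.
rewrite -[y](as_polyK v) horner_coef; apply: ideal_sum => // i _.
by apply: idealZr.
Qed.

Lemma free_of_add_gen v J g : ideal J -> free_of v J -> as_poly v g = g%:P ->
  free_of v (add_gen J g).
Proof.
move=> iJ vJ vg _ [j Jj [z ->]]; have iJ' := ideal_add_gen g iJ.
have iJX := ideal_poly_ideal iJ'; rewrite rmorphD rmorphM /= vg; apply: (idealD iJX).
  by move=> i; apply: sub_add_gen; apply: vJ.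
apply: (idealZ _ iJX).
by apply: poly_idealC => //; apply: mem_add_gen.
Qed.

Lemma weakly_regular_vars J (f : V -> {poly k}) (s : seq V) : ideal J -> uniq s ->
  (forall v, v \in s -> free_of v J) -> (forall v, v \in s -> f v != 0) ->
  weakly_regular J [seq eval_at (f v) (X v) | v <- s].
Proof.
elim: s J => //= v s IHs J iJ /andP[vs us] sJ f0; split.
  by apply: free_of_regular => //; [apply: sJ|apply: f0]; rewrite mem_head.
apply: IHs => // [|u us'|u us']; first exact: ideal_add_gen.
- apply: free_of_add_gen => //; first by apply: sJ; rewrite inE us' orbT.
  by apply: as_poly_eval_atXn; apply: contraNneq vs => ->.
- by apply: f0; rewrite inE us' orbT.
Qed.

(** For this complex the Stanley-Reisner ideal is generated by the variables outside
F, which is why it is free of the vertices in F. *)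
Definition simplex F : {set V} -> bool := fun A => A \subset F.

Lemma down_closed_simplex F : down_closed (simplex F).
Proof. by move=> A B; apply: subset_trans. Qed.

Lemma simplex_var F u : u \notin F -> stanley_reisner (simplex F) (X u).
Proof.
move=> uF m; rewrite /vertex_var msuppX inE => /eqP->.
by rewrite msuppvU /simplex sub1set.
Qed.

Lemma free_of_simplex v F : v \in F -> free_of v (stanley_reisner (simplex F)).
Proof.
move=> vF p Jp; set J := stanley_reisner _ in Jp *.
have iJ : ideal J by apply: ideal_stanley_reisner; apply: down_closed_simplex.
have iJX := ideal_poly_ideal iJ.
rewrite [p]mpolyE rmorph_sum big_seq; apply: (ideal_sum _ iJX) => m /Jp /subsetPn[u um uF].
have -> : 'X_[m] = 'X_[m - U_(enum_rank u)] * X u :> S.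
  rewrite /vertex_var -mpolyXD submK //; apply/mnm_lepP => i.
  by rewrite mnm1E; case: eqP => // <-; move: um; rewrite inE lt0n.
rewrite -mul_mpolyC !rmorphM /=; do 2 apply: (idealZ _ iJX).
rewrite as_polyXn; last by apply: contraNneq uF => ->.
by apply: poly_idealC => //; apply: simplex_var.
Qed.

Variables (T : finType) (col : V -> T).

Definition col_sum t : S := \sum_(v | col v == t) X v.

(** A vertex decomposition in which the facets are transversals of the fibres of
col; the star is used in place of the link, so that all the complexes have the same
vertex set. *)
Inductive decomposable : ({set V} -> bool) -> Prop :=
| decomposable_simplex F : (forall t, exists2 v, v \in F & col v = t) ->
    {in F &, injective col} -> decomposable (simplex F)
| decomposable_vertex D v : decomposable (fun A => D (v |: A)) ->
    decomposable (fun A => D A && (v \notin A)) -> decomposable D.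

(** On a simplex with transversal F, the sum over a fibre of col is congruent to the
variable of its vertex in F, and polynomials in distinct variables form a regular
sequence.  Each vertex step is an instance of [weakly_regular_extension]. *)
Lemma decomposable_weakly_regular D (f : T -> {poly k}) (s : seq T) :
  down_closed D -> decomposable D -> uniq s -> (forall t, t \in s -> f t != 0) ->
  weakly_regular (stanley_reisner D) [seq eval_at (f t) (col_sum t) | t <- s].
Proof.
move=> + decD us f0; elim: decD => {D} [F Fcol Finj|D v _ IHstar _ IHdel] dD.
  have /choice[r rP] (t : T) : exists v, v \in F /\ col v = t.
    by have [v vF vt] := Fcol t; exists v.
  have iJ := ideal_stanley_reisner dD.
  apply: (@weakly_regular_congr _ _ _ _ _ (fun t => eval_at (f t) (X (r t)))) => // [t ts|].
    apply: (@ideal_horner _ _ _ _ _ iJ); rewrite /col_sum (bigD1 (r t)) /=; last by apply/eqP; case: (rP t).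
    rewrite addrAC subrr add0r; apply: (ideal_sum _ iJ) => u /andP[/eqP ut ur].
    apply: simplex_var; apply: contra ur => uF; apply/eqP; apply: Finj => //.
      by case: (rP t).
    by rewrite ut; case: (rP t).
  have rK : cancel r col by move=> t; case: (rP t).
  rewrite -[X in weakly_regular _ X](_ : [seq eval_at (f (col v)) (X v) | v <- map r s] = _).
    apply: weakly_regular_vars => //; first by rewrite map_inj_uniq //; apply: can_inj rK.
      by move=> _ /mapP[t _ ->]; apply: free_of_simplex; case: (rP t).
    by move=> _ /mapP[t ts ->]; rewrite rK; apply: f0.
  by rewrite -map_comp; apply: eq_map => t /=; rewrite rK.
apply: (@weakly_regular_extension _ _ (X v)); first exact: ideal_stanley_reisner.
  rewrite colon_stanley_reisner; apply: IHstar => A B AB.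
  by apply: dD; apply: setUS.
rewrite add_gen_stanley_reisner //; apply: IHdel => A B AB /andP[DB vB].
by rewrite (dD A B) //=; apply: contra vB; apply: (subsetP AB).
Qed.

End Simplex.

Section EdgeIdeal.
Variable G : sgraph V.

Definition independent (A : {set V}) := [forall u in A, forall v in A, ~~ G u v].

Lemma independentP (A : {set V}) :
  reflect {in A &, forall u v, ~~ G u v} (independent A).
Proof.
apply: (iffP forall_inP) => [h u v uA vA|h u uA].
  by have /forall_inP := h u uA; apply.
by apply/forall_inP => v vA; apply: h.
Qed.

Lemma down_closed_independent : down_closed independent.
Proof.
move=> A B /subsetP AB /independentP indB; apply/independentP => u v uA vA.
by apply: indB; apply: AB.
Qed.

(** A monomial lies in the edge ideal exactly when its support contains an edge. *)
Lemma edge_idealE p : p \in edge_ideal (k := k) G <-> stanley_reisner independent p.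
Proof.
have iJ := ideal_stanley_reisner down_closed_independent.
split=> [|Jp].
  apply: gen_ideal_min => // g /mapP[[u v]]; rewrite mem_enum inE /= => uv ->.
  move=> m; rewrite /vertex_var -mpolyXD msuppX inE => /eqP->.
  rewrite msuppvD !msuppvU; apply/negP => /independentP/(_ u v).
  by rewrite !inE !eqxx orbT uv; move/(_ isT isT).
have iI := ideal_gen (edge_monomials k G).
rewrite [p]mpolyE big_seq.
apply: (@ideal_sum _ (fun p => p \in gen_ideal (edge_monomials k G))) => // m /Jp.
rewrite negb_forall_in => /exists_inP[u um]; rewrite negb_forall_in => /exists_inP[v vm].
rewrite negbK => uv.
have -> : 'X_[m] = 'X_[m - (U_(enum_rank u) + U_(enum_rank v))] * (X u * X v) :> S.
  rewrite /vertex_var -!mpolyXD submK //; apply/mnm_lepP => i.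
  rewrite mnmDE !mnm1E; move: um vm; rewrite !inE => um vm.
  case: (enum_rank u =P i) => [<-|_]; case: (enum_rank v =P _) => [iv|_] //.
  - by move: uv; rewrite (enum_rank_inj iv) adj_irrefl.
  - by rewrite lt0n.
  - by rewrite -iv lt0n.
rewrite -mul_mpolyC mulrA.
apply: (@idealZ _ (fun p => p \in gen_ideal (edge_monomials k G))) => //.
apply: mem_gen_ideal; apply/mapP; exists (u, v) => //.
by rewrite mem_enum.
Qed.

End EdgeIdeal.

End StanleyReisner.

(** * Decomposing the independence complex *)

Section IndependenceComplex.
Variables (V : finType) (G : sgraph V).
Implicit Types (A W F : {set V}) (v w x : V).

Definition independence_complex W : {set V} -> bool :=
  fun A => (A \subset W) && independent G A.

Lemma independence_complexT : independence_complex setT = independent G.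
Proof. by apply/funext => A; rewrite /independence_complex subsetT. Qed.

Lemma independence_complex_star W x : x \in W ->
  (fun A => independence_complex W (x |: A)) =
  independence_complex (W :\: [set w | G x w]).
Proof.
move=> xW; apply/funext => A; apply/idP/idP => /andP[AW /independentP ind].
  apply/andP; split; last first.
    by apply/independentP => u v uA vA; apply: ind; rewrite inE (uA, vA) orbT.
  apply/subsetP => u uA; rewrite !inE (subsetP AW) ?inE ?uA ?orbT // andbT.
  by apply: ind; rewrite !inE ?eqxx ?uA ?orbT.
have AxW u : u \in A -> ~~ G x u && (u \in W).
  by move/(subsetP AW); rewrite !inE.
apply/andP; split.
  by apply/subsetP => u /setU1P[->//|/AxW/andP[]].
apply/independentP => u v /setU1P[->|uA] /setU1P[->|vA].
- by rewrite adj_irrefl.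
- by case/andP: (AxW v vA).
- by rewrite adj_sym; case/andP: (AxW u uA).
- exact: ind.
Qed.

Lemma independence_complex_del W x :
  (fun A => independence_complex W A && (x \notin A)) = independence_complex (W :\ x).
Proof.
by apply/funext => A; rewrite /independence_complex subsetD1 -!andbA [_ && (_ \notin _)]andbC.
Qed.

Lemma independence_complex_simplex F : independent G F ->
  independence_complex F = simplex F.
Proof.
move=> indF; apply/funext => A; rewrite /independence_complex /simplex.
by apply: andb_idr => AF; apply: down_closed_independent AF indF.
Qed.

End IndependenceComplex.

Section Decomposition.
Variables (r n : nat) (hr : 0 < r) (G : sgraph ('I_r * 'I_n)%type).
Hypotheses (hpart : forall (a : 'I_r) (i j : 'I_n), ~~ G (a, i) (a, j))
  (h1 : forall (i : 'I_n) (a b : 'I_r), (a < b)%N -> G (a, i) (b, i))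
  (h2 : forall (a b : 'I_r) (i j : 'I_n),
      (a < b)%N -> G (a, i) (b, j) -> (i <= j)%N)
  (hsplit : forall (a c b : 'I_r) (i j : 'I_n), a < c -> c < b ->
     (G (a, i) (b, j) <-> exists2 t, G (a, i) (c, t) & G (c, t) (b, j)))
  (h4 : forall (a b : 'I_r), b = a.+1 :> nat -> forall i j l : 'I_n,
      G (a, i) (b, j) -> G (a, j) (b, l) -> G (a, i) (b, l)).
Local Notation V := ('I_r * 'I_n)%type.
Implicit Types (U F : {set V}) (a b c d : 'I_r) (i j l : 'I_n).

(** The sets of vertices that disappear from later columns during the
decomposition.  They are closed upwards for adjacency, and also under replacing j
by l within a layer c when the layer below links j to l. *)
Definition removable U :=
  [/\ forall c j, (c, j) \in U -> 0 < c,
      forall a c j l, c = a.+1 :> nat -> (c, j) \in U -> G (a, j) (c, l) -> (c, l) \in U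
    & forall c d j l, c < d -> (c, j) \in U -> G (c, j) (d, l) -> (d, l) \in U].

Definition above b i : {set V} := [set v : V | (b < v.1) && G (b, i) v].

(** A vertex above (b, i) is reached through the layer just below its own
([hsplit]), and two consecutive steps between the same layers compose ([h4]). *)
Lemma removable_above U b i : removable U -> removable (U :|: above b i).
Proof.
case=> U0 Ustep Uup; split.
- by move=> c j; rewrite !inE => /orP[/U0//|/andP[bc _]]; apply: leq_ltn_trans bc.
- move=> a c j l ca; rewrite !inE /= => /orP[jU|/andP[bc bj]] jl.
    by rewrite (Ustep a c j l).
  apply/orP; right; rewrite bc /=; have [ba|ba] := ltnP b a.
    have ac : a < c by rewrite ca.
    have [t bt tj] := (hsplit _ _ ba ac).1 bj.
    by apply/(hsplit _ _ ba ac); exists t => //; apply: h4 tj jl.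
  have ab : a = b by apply: val_inj => /=; apply/eqP; rewrite eqn_leq ba -ltnS -ca bc.
  by rewrite ab in jl; apply: h4 bj jl; rewrite ca ab.
- move=> c d j l cd; rewrite !inE /= => /orP[jU|/andP[bc bj]] jl.
    by rewrite (Uup c d j l).
  apply/orP; right; rewrite (ltn_trans bc cd) /=.
  by apply/(hsplit _ _ bc cd); exists j.
Qed.

(** The columns before p have been treated, leaving the vertices F; those from p on
have lost U. *)
Definition remaining F U (p : nat) : {set V} :=
  F :|: [set v : V | (p <= v.2) && (v \notin U)].

(** Let i be the column number p and (m, i) its highest vertex outside U.  The
vertices (b, i) with b < m are split off from the bottom.  Keeping (b, i) forces out
the rest of its column and all vertices of later columns above it, so U grows by
[above b i].  Once all of them are deleted, (m, i) is isolated: an edge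
from it to a surviving vertex of a later column would start with a step into
layer m + 1 at an index t linked to i, where (m + 1, i) is in U, whence (m + 1, t)
and everything above it is in U as well. *)
Lemma decomposable_remaining F U (p : nat) : p <= n -> removable U ->
  (forall v, v \in F -> v.2 < p) ->
  (forall i, i < p -> exists2 v, v \in F & v.2 = i) ->
  {in F &, injective snd} ->
  (forall v w, v \in F -> w \in remaining F U p -> ~~ G v w) ->
  decomposable snd (independence_complex G (remaining F U p)).
Proof.
move: {2}(n - p) (erefl (n - p)) => N; elim: N F U p => [|N IHN] F U p.
  move=> pn pn' _ Fp Fcol Finj Fiso.
  have {pn pn'}pn : p = n by apply/eqP; rewrite eqn_leq pn' -subn_eq0 pn.
  have WF : remaining F U p = F.
    apply/setP => v; rewrite !inE; apply/orb_idr => /andP[].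
    by rewrite pn leqNgt ltn_ord.
  rewrite WF in Fiso *; rewrite independence_complex_simplex; last first.
    by apply/independentP => u v uF vF; apply: Fiso.
  by apply: decomposable_simplex => // i; apply: Fcol; rewrite pn.
move=> pN _ rU Fp Fcol Finj Fiso; have [U0 Ustep Uup] := rU.
have pn : p < n by rewrite -subn_gt0 pN.
pose i := Ordinal pn.
have [m mU mmax] : exists2 m, (m, i) \notin U & forall c, (c, i) \notin U -> c <= m.
  have h0 : (Ordinal hr, i) \notin U by apply/negP => /U0.
  by case: (@arg_maxnP _ (Ordinal hr) (fun c => (c, i) \notin U) val h0) => m ? ?; exists m.
have ltU c : c <= m -> (c, i) \notin U.
  rewrite leq_eqVlt => /orP[/eqP/val_inj->//|cm].
  by apply: contra mU => cU; apply: (Uup c m i i cm cU (h1 i cm)).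
(* What is left when the vertices of column i below layer b have been deleted. *)
pose W (b : nat) := F :|: [set v : V | (v.2 == i) && (b <= v.1 <= m)]
              :|: [set v : V | (p < v.2) && (v \notin U)].
have W0 : remaining F U p = W 0.
  apply/setP => -[c j]; rewrite !inE /= -orbA; congr (_ || _).
  rewrite leq_eqVlt andb_orl; congr (_ || _).
  rewrite eq_sym; have [->|//] := eqVneq j i.
    rewrite eqxx /=; apply/idP/idP; [exact: mmax|exact: ltU].
  by rewrite -val_eqE /= => /negPf->.
(* The passage to the next column, with (b, i) as the vertex kept. *)
have next b (U' : {set V}) : b <= m -> removable U' ->
    (forall v : V, p < v.2 -> v \notin U' -> (v \notin U) && ~~ G (b, i) v) ->
    decomposable snd (independence_complex G (remaining ((b, i) |: F) U' p.+1)).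
  move=> bm rU' U'P.
  have iW : (b, i) \in remaining F U p by rewrite !inE /= leqnn ltU ?orbT.
  apply: IHN => //.
  - by rewrite subnS pN.
  - by move=> v /setU1P[->//|/Fp]; apply: leqW.
  - move=> j; rewrite ltnS leq_eqVlt => /orP[/eqP jp|/Fcol[v vF <-]].
      by exists (b, i); rewrite ?setU11 //; apply: val_inj.
    by exists v => //; rewrite inE vF orbT.
  - move=> u v /setU1P[->|uF] /setU1P[->|vF] //=.
    + by move=> iv; have := Fp v vF; rewrite -iv ltnn.
    + by move=> ui; have := Fp u uF; rewrite ui ltnn.
    + exact: Finj.
  move=> u v /setU1P[->|uF]; rewrite !inE -orbA => /or3P[/eqP->|vF|/andP[pv vU']].
  - exact: hpart.
  - by rewrite adj_sym; apply: Fiso => //; rewrite !inE vF.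
  - by case/andP: (U'P v pv vU').
  - exact: Fiso.
  - by apply: Fiso => //; rewrite !inE vF.
  - apply: Fiso => //; rewrite !inE (ltnW pv).
    by case/andP: (U'P v pv vU') => ->; rewrite orbT.
have topP (v : V) : p < v.2 -> v \notin U -> (v \notin U) && ~~ G (m, i) v.
  case: v => c j /= pj jU; rewrite jU /=; apply/negP => mj.
  have [mc|cm|/val_inj mc] := ltngtP m c; last first.
  - by move: mj; rewrite mc (negPf (hpart _ _ _)).
  - by move: mj; rewrite adj_sym => /(h2 cm); rewrite leqNgt pj.
  have sr : m.+1 < r by apply: leq_ltn_trans (ltn_ord c).
  pose s := Ordinal sr; have sU : (s, i) \in U.
    by apply: contraT => /mmax; rewrite /= ltnn.
  case/negP: jU; have [sc|cs] := ltnP s c.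
    have [t it tj] := (hsplit i j (ltnSn m : m < s) sc).1 mj.
    by apply: Uup sc _ tj; apply: Ustep sU it.
  have cE : c = s by apply: val_inj; apply/eqP; rewrite eqn_leq cs /=.
  by rewrite cE; apply: Ustep sU _ => //; rewrite -cE.
suff H (b : nat) : b <= m -> decomposable snd (independence_complex G (W b)) by rewrite W0; apply: H.
move=> bm; rewrite -(subKn bm); elim: (m - b) (leq_subr b m) => {b bm} [_|q IHq qm].
  rewrite subn0; have -> : W m = remaining ((m, i) |: F) U p.+1.
    apply/setP => -[c j]; rewrite !inE /= -eqn_leq xpair_eqE [in RHS]andbC; congr (_ || _).
    by rewrite orbC [m == _ :> nat]eq_sym.
  exact: next.
have br : m - q.+1 < r by apply: leq_ltn_trans (leq_subr _ _) (ltn_ord m).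
have [b bE] : exists b : 'I_r, b = m - q.+1 :> nat by exists (Ordinal br).
rewrite -bE; pose x : V := (b, i).
have bm : b < m by rewrite bE subnS prednK ?subn_gt0 ?leq_subr.
have xW : x \in W b by rewrite !inE /= eqxx leqnn (ltnW bm) orbT.
have xF v : v \in F -> ~~ G x v.
  move=> vF; rewrite adj_sym; apply: Fiso => //.
  by rewrite W0 !inE /= eqxx (ltnW bm) orbT.
have aboveE (v : V) : p < v.2 -> (v \in above b i) = G x v.
  case: v => c j /= pj; rewrite inE /=; apply: andb_idl => xv.
  rewrite ltnNge leq_eqVlt; apply/negP => /orP[/eqP cb|cb].
    by move: xv; rewrite (val_inj cb) (negPf (hpart _ _ _)).
  by move: xv; rewrite adj_sym => /(h2 cb); rewrite leqNgt pj.
apply: (@decomposable_vertex _ _ _ _ x).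
  rewrite independence_complex_star //.
  have -> : W b :\: [set w | G x w] = remaining (x |: F) (U :|: above b i) p.+1.
    apply/setP => -[c j]; rewrite !in_setU !in_setD !in_set in_set1 /= negb_or.
    have [vF|vF] := boolP ((c, j) \in F); first by rewrite xF // orbT.
    rewrite orbF /= xpair_eqE; have [->|ji] := eqVneq j i.
      rewrite ltnn andbT !orbF /=.
      have [bc|cb|bc] := ltngtP b c.
      + by rewrite h1 //=; apply/esym/negbTE; rewrite -val_eqE /= gtn_eqF.
      + by rewrite andbF; apply/esym/negbTE; rewrite -val_eqE /= ltn_eqF.
      + rewrite -(val_inj bc) adj_irrefl eqxx /=; exact: ltnW.
    rewrite andbF /=; have [pj|] := boolP (p < j); last by rewrite andbF.
    by have := aboveE (c, j) pj; rewrite inE /= => ->; rewrite andbC.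
  apply: next; [exact: ltnW|exact: removable_above|move=> v pv].
  by rewrite in_setU negb_or aboveE.
rewrite independence_complex_del.
have -> : W b :\ x = W (m - q).
  have -> : m - q = b.+1 by rewrite bE subnS prednK // subn_gt0.
  apply/setP => -[c j]; rewrite !inE /= xpair_eqE.
  have [vF|vF] := boolP ((c, j) \in F).
    by rewrite /= andbT; apply: contraTN vF => /andP[_ /eqP->]; apply/negP => /Fp; rewrite ltnn.
  have [->|ji] := eqVneq j i; last by rewrite andbF.
  by rewrite ltnn /= !orbF andbT andbA -val_eqE /= eq_sym -ltn_neqAle.
by apply: IHq; apply: ltnW.
Qed.

Lemma decomposable_independent : decomposable snd (independent G).
Proof.
have -> : independent G = independence_complex G (remaining set0 set0 0).
  rewrite -independence_complexT; congr independence_complex.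
  by apply/setP => v; rewrite !inE.
apply: decomposable_remaining => // [|v|u v|v w]; rewrite ?inE //.
by split=> [c j|a c j l _|c d j l _]; rewrite inE.
Qed.

End Decomposition.

Section Walks.
Variables (r n : nat) (G : sgraph ('I_r * 'I_n)%type).
Hypotheses
  (h2 : forall (a b : 'I_r) (i j : 'I_n),
      (a < b)%N -> G (a, i) (b, j) -> (i <= j)%N)
  (h3 : forall (a b : 'I_r) (i j : 'I_n), (a < b)%N ->
      (G (a, i) (b, j) <->
       exists t : (b - a - 1).-tuple 'I_n,
         sorted (fun x y : 'I_n => (x <= y)%N) t /\
         edge_walk G a (i :: rcons t j))).
Implicit Types (a b c d : 'I_r) (i j t : 'I_n).

(** Walks as functions of the number of steps are easier to cut and to concatenate
than sequences. *)
Definition steps a m (w : nat -> 'I_n) := forall l c d, l < m ->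
  c = a + l :> nat -> d = (a + l).+1 :> nat -> G (c, w l) (d, w l.+1).

(** When such a function is turned back into a sequence, [h2] makes it
non-decreasing. *)
Lemma adj_steps a b i j : a < b -> (G (a, i) (b, j) <->
  exists w, [/\ w 0 = i, w (b - a) = j & steps a (b - a) w]).
Proof.
move=> ab; rewrite h3 //; split=> [[t [_ tw]]|[w [w0 wm wst]]].
  have st : size (i :: rcons t j) = (b - a).+1.
    by rewrite /= size_rcons size_tuple -subnDA addn1 subnSK.
  exists (nth i (i :: rcons t j)); split=> //.
    by rewrite -[X in nth _ _ X]/((b - a).+1.-1) -st nth_last /= last_rcons.
  by move=> l c d lb ca da; apply: tw; rewrite ?st.
have tE : [seq w l | l <- iota 1 (b - a - 1)] = [tuple w l.+1 | l < b - a - 1] :> seq _.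
  by rewrite /= -(addn0 1) iotaDl -val_enum_ord -!map_comp.
exists [tuple w l.+1 | l < b - a - 1].
have wE : i :: rcons [tuple w l.+1 | l < b - a - 1] j = [seq w l | l <- iota 0 (b - a).+1].
  rewrite -tE -cats1 -[[:: j]]/(map id [:: j]) -wm.
  have -> : (b - a).+1 = 1 + ((b - a - 1) + 1) by lia.
  by rewrite iotaD map_cat /= w0 iotaD map_cat /= add1n subn1 prednK // subn_gt0.
split.
  rewrite -tE; apply/(sortedP i) => l; rewrite size_map size_iota => lb.
  rewrite !(nth_map 0) ?size_iota ?(ltnW lb) // !nth_iota ?(ltnW lb) //.
  have cr : a + l.+1 < r by have := ltn_ord b; lia.
  have dr : (a + l.+1).+1 < r by have := ltn_ord b; lia.
  have /h2 : G (Ordinal cr, w l.+1) (Ordinal dr, w l.+2) by apply: wst => //; lia.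
  by rewrite /= !add1n; apply.
rewrite wE => x0 l c d; rewrite size_map size_iota => lb ca da.
rewrite !(nth_map 0) ?size_iota ?(ltnW lb) // !nth_iota ?(ltnW lb) //.
exact: wst.
Qed.

(** Transitivity of the relation between layers, and its converse: an edge can be cut
at any intermediate layer. *)
Lemma adj_split a c b i j : a < c -> c < b ->
  (G (a, i) (b, j) <-> exists2 t, G (a, i) (c, t) & G (c, t) (b, j)).
Proof.
move=> ac cb; have ab := ltn_trans ac cb; rewrite (adj_steps _ _ ab); split.
  case=> w [w0 wm wst]; exists (w (c - a)).
    apply/(adj_steps _ _ ac); exists w; split=> // l d e lc da ea.
    by apply: wst => //; lia.
  apply/(adj_steps _ _ cb); exists (fun l => w (c - a + l)); split.
  - by rewrite addn0.
  - by rewrite -wm; congr w; lia.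
  - by move=> l d e lb dc ec; rewrite addnS; apply: wst; lia.
case=> t /(adj_steps _ _ ac)[u [u0 um ust]] /(adj_steps _ _ cb)[v [v0 vm vst]].
exists (fun l => if l <= c - a then u l else v (l - (c - a))); split.
- by rewrite leq0n.
- by rewrite leqNgt ltn_sub2r //= -vm; congr v; lia.
move=> l d e lb da ea; have [lc|cl|lc] := ltngtP l (c - a).
- exact: ust.
- rewrite subSn; last exact: ltnW.
  by apply: vst; lia.
- by rewrite lc um -v0 subSn // subnn; apply: vst; lia.
Qed.

End Walks.

(** * Localization at a prime *)

Section LocalRing.
Local Open Scope ring_scope.

(** Depth never exceeds dimension, so one regular sequence as long as the dimension
allows pins down both. *)
Lemma local_cohen_macaulay_intro (L : comNzRingType) (m : prime_idealr L) s :
  is_local m -> regular_seq s -> {subset s <= m} ->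
  (forall d p, @prime_chain L d p -> (d <= size s)%N) -> local_cohen_macaulay L.
Proof.
move=> locm regs sm dimL; exists m, (size s); split=> //.
  by split=> //; have [p ps _] := regular_prime_chain regs sm; exists p.
split; first by exists s.
by move=> t regt tm; have [p pt _] := regular_prime_chain regt tm; apply: dimL pt.
Qed.

End LocalRing.

Section Localization.
Local Open Scope ring_scope.
Variables (R : comNzRingType) (P : prime_idealr R).
Local Notation L := (localization P).

Lemma loc_frac_add a s b t (sP : s \notin P) (tP : t \notin P) :
  loc_frac a sP + loc_frac b tP = loc_frac (a * t + b * s) (notin_primeM sP tP).
Proof. exact: loc_fracD. Qed.

Lemma loc_frac_opp a s (sP : s \notin P) : - loc_frac a sP = loc_frac (- a) sP.
Proof. exact: loc_fracN. Qed.

Lemma loc_frac_mul a s b t (sP : s \notin P) (tP : t \notin P) :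
  loc_frac a sP * loc_frac b tP = loc_frac (a * b) (notin_primeM sP tP).
Proof. exact: loc_fracM. Qed.

(** The canonical map from R to its localization at P. *)
Definition to_loc (a : R) : L := loc_frac a (notin_prime1 P).

Fact to_loc_zmod : zmod_morphism to_loc.
Proof.
move=> a b; rewrite /to_loc loc_frac_opp loc_frac_add.
by apply: loc_frac_ext; ring.
Qed.

Fact to_loc_monoid : monoid_morphism to_loc.
Proof.
split=> // a b; rewrite /to_loc loc_frac_mul.
by apply: loc_frac_ext; ring.
Qed.

HB.instance Definition _ := GRing.isZmodMorphism.Build R L to_loc to_loc_zmod.
HB.instance Definition _ := GRing.isMonoidMorphism.Build R L to_loc to_loc_monoid.

Lemma to_loc_unit s : s \notin P -> exists v, to_loc s * v = 1.
Proof.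
move=> sP; exists (loc_frac 1 sP); rewrite loc_frac_mul.
by apply: loc_frac_ext; ring.
Qed.

Lemma to_loc_den y : exists a s, s \notin P /\ y * to_loc s = to_loc a.
Proof.
have [a [s [sP ->]]] := loc_frac_surj y; exists a, s; split=> //.
by rewrite loc_frac_mul; apply: loc_frac_ext; ring.
Qed.

Lemma to_loc_eq0 a : to_loc a = 0 -> exists2 u, u \notin P & u * a = 0.
Proof.
by case/loc_frac_eq => u uP; rewrite !mulr1 mulr0 => ua; exists u.
Qed.

(** The maximal ideal P R_P: the fractions with numerator in P. *)
Definition loc_max : L -> bool :=
  fun x => `[< exists a s (sP : s \notin P), a \in P /\ x = loc_frac a sP >].

Lemma loc_maxE a s (sP : s \notin P) : (loc_frac a sP \in loc_max) = (a \in P).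
Proof.
apply/asboolP/idP => [[b [t [tP [bP]]]]|aP]; last by exists a, s, sP.
case/loc_frac_eq => u uP e.
have : u * (a * t) \in P by rewrite e !prime_idealrM bP orbT.
by rewrite !prime_idealrM (negPf uP) (negPf tP) orbF.
Qed.

Fact loc_max_idealr : idealr_closed loc_max.
Proof.
split; first by rewrite -[0]/(to_loc 0) loc_maxE idealr0.
  by rewrite -[1]/(to_loc 1) loc_maxE idealr1.
move=> x y z; have [a [s [sP ->]]] := loc_frac_surj x.
have [b [t [tP ->]]] := loc_frac_surj y; have [c [u [uP ->]]] := loc_frac_surj z.
move=> bP cP; rewrite loc_maxE in bP; rewrite loc_maxE in cP.
rewrite loc_frac_mul loc_frac_add loc_maxE rpredD //; first by rewrite mulrC !idealMr.
by rewrite mulrC idealMr.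
Qed.

Fact loc_max_prime : prime_idealr_closed loc_max.
Proof.
move=> x y; have [a [s [sP ->]]] := loc_frac_surj x.
have [b [t [tP ->]]] := loc_frac_surj y.
by rewrite loc_frac_mul !loc_maxE prime_idealrM.
Qed.

HB.instance Definition _ := isIdealr.Build L loc_max loc_max_idealr.
HB.instance Definition _ := isPrimeIdealrClosed.Build L loc_max loc_max_prime.

Lemma to_loc_max a : (to_loc a \in loc_max) = (a \in P).
Proof. exact: loc_maxE. Qed.

Lemma sub_loc_max (J : idealr L) : {subset J <= loc_max}.
Proof.
move=> x; have [a [s [sP ->]]] := loc_frac_surj x => xJ.
rewrite loc_maxE; apply: contraT => aP.
have := idealMr (loc_frac s aP) xJ; rewrite loc_frac_mul.
have -> : loc_frac (s * a) (notin_primeM aP sP) = 1.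
  by apply: loc_frac_ext; ring.
by rewrite idealr1.
Qed.

Lemma is_local_localization : is_local (loc_max : idealr L).
Proof.
move=> J; split=> [maxJ x|JE K JK x /sub_loc_max]; last by rewrite JE.
apply/idP/idP; first exact: sub_loc_max.
by apply: (maxJ (loc_max : idealr L)); apply: sub_loc_max.
Qed.

End Localization.

(** Here L is the localization of S/I at the image of the multiplicative set T, which
is stated through the three characteristic properties of the map f from S to L. *)
Section LocalizedSequences.
Local Open Scope ring_scope.
Variables (S L : comNzRingType) (f : {rmorphism S -> L}) (I T : S -> Prop).
Hypotheses (idI : ideal I) (fI : forall x, I x -> f x = 0)
  (TM : forall s t, T s -> T t -> T (s * t))
  (fT : forall t, T t -> exists v, f t * v = 1)
  (fden : forall y, exists a s, T s /\ y * f s = f a)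
  (fker : forall x, f x = 0 -> exists2 u, T u & I (u * x)).

(** The extension of J to L, written with a common denominator. *)
Definition extension (J : S -> Prop) (y : L) := exists t a, [/\ T t, J a & y * f t = f a].

Lemma extension_regular J g y : ideal J -> (forall x, I x -> J x) ->
  (forall x, J (x * g) -> J x) -> extension J (y * f g) -> extension J y.
Proof.
move=> idJ IJ regg [t [a [Tt Ja yE]]]; have [b [s [Ts bE]]] := fden y.
have [|u Tu Iu] := @fker (b * g * t - a * s).
  rewrite rmorphB !rmorphM -bE -yE; ring.
exists (s * (u * t)), (b * (u * t)); split; first by do 2 apply: TM => //.
  apply: regg.
  have -> : b * (u * t) * g = u * (b * g * t - a * s) + u * s * a by ring.
  by apply: idealD => //; [apply: IJ|apply: idealZ].
by rewrite rmorphM mulrA bE -rmorphM.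
Qed.

Lemma extension_rcons J g hs : ideal J ->
  (forall y, y \in gen_ideal (map f hs) <-> extension J y) ->
  forall y, y \in gen_ideal (map f (rcons hs g)) <-> extension (add_gen J g) y.
Proof.
move=> idJ hsJ y; rewrite map_rcons gen_ideal_rcons; split.
  case=> y' /hsJ[t [a [Tt Ja y'E]]] [z ->]; have [b [s [Ts bE]]] := fden z.
  exists (t * s), (s * a + b * t * g); split; first exact: TM.
    by exists (s * a); [apply: idealZ|exists (b * t)].
  rewrite !(rmorphD, rmorphM) -y'E -bE; ring.
case=> t [_ [Tt [a Ja [z ->]] yE]]; have [v vt] := fT Tt.
exists (v * f a).
  by apply/hsJ; exists t, a; split=> //; rewrite mulrAC [v * _]mulrC vt mul1r.
exists (v * f z); have -> : y = v * (y * f t) by rewrite mulrCA [v * _]mulrC vt mulr1.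
by rewrite yE rmorphD rmorphM; ring.
Qed.

Lemma weakly_regular_map J hs gs : ideal J -> (forall x, I x -> J x) ->
  (forall y, y \in gen_ideal (map f hs) <-> extension J y) ->
  weakly_regular J gs -> forall i y, (i < size gs)%N ->
  y * f gs`_i \in gen_ideal (map f (hs ++ take i gs)) ->
  y \in gen_ideal (map f (hs ++ take i gs)).
Proof.
elim: gs J hs => //= g gs IHgs J hs idJ IJ hsJ [regg reggs] [|i] y; rewrite ?cats0.
  by move=> _ /hsJ h; apply/hsJ; apply: extension_regular h.
rewrite ltnS -cat_rcons; apply: (IHgs (add_gen J g)) => //.
- exact: ideal_add_gen.
- by move=> x /IJ; apply: sub_add_gen.
- exact: extension_rcons.
Qed.

Lemma regular_seq_map gs : weakly_regular I gs -> T 1 ->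
  1 \notin gen_ideal (map f gs) -> regular_seq (map f gs).
Proof.
move=> reggs T1 prop; split=> // i; rewrite size_map => ilt y.
rewrite (nth_map 0) // -map_take -[take i gs]cat0s.
apply: (@weakly_regular_map I) => // z; split=> [|[t [a [Tt Ia zE]]]].
  move/(@gen_ideal_min _ (fun z => z = 0)) => -> //.
    by exists 1, 0; rewrite mul0r rmorph0; split=> //; apply: ideal0.
  by split=> // b x w -> ->; rewrite mulr0 addr0.
have [v vt] := fT Tt.
have -> : z = 0 by rewrite -[z]mulr1 -vt mulrA zE fI // mul0r.
exact: (ideal_gen _).1.
Qed.

Lemma chain_of_primes_preim d (q : nat -> L -> Prop) :
  chain_of_primes d q -> chain_of_primes d (fun i x => q i (f x)).
Proof.
move=> [pr qS]; split=> [i|i id]; first exact: prime_ideal_preim.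
have [sub [y qy nqy]] := qS i id; split; first by move=> x; apply: sub.
have [b [s [Ts bE]]] := fden y; have [v vs] := fT Ts.
have [iq _ _] := pr i; have [iq' _ _] := pr i.+1; exists b.
  by rewrite -bE; apply: idealZr.
rewrite -bE => qys; apply: nqy.
by rewrite -[y]mulr1 -vs mulrA; apply: idealZr.
Qed.

End LocalizedSequences.

(** * The edge ring *)

Section Residue.
Local Open Scope ring_scope.
Local Open Scope quotient_scope.

Section AsField.
Variables (K : comNzRingType) (fieldK : forall x : K, x != 0 -> exists y, y * x = 1).

(** K with its inverse operation supplied by choice. *)
Definition as_field : Type := K.
HB.instance Definition _ := GRing.ComNzRing.on as_field.

Definition as_field_inv (x : as_field) : as_field :=
  if pselect (x != 0) is left x0 then sval (cid (fieldK x0)) else 0.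

Fact as_field_mulVf (x : as_field) : x != 0 -> as_field_inv x * x = 1.
Proof.
move=> x0; rewrite /as_field_inv; case: pselect => // x0'.
exact: (svalP (cid (fieldK x0'))).
Qed.

Fact as_field_inv0 : as_field_inv 0 = 0.
Proof. by rewrite /as_field_inv; case: pselect => // x0; case/eqP: (x0). Qed.

HB.instance Definition _ :=
  GRing.ComNzRing_isField.Build as_field as_field_mulVf as_field_inv0.

Lemma zariski_ring (k : fieldType) (f : {rmorphism k -> K}) xs (y : K) :
  generated_over f xs -> exists2 p, p != 0 & (map_poly f p).[y] = 0.
Proof.
move=> genf; have [z z0|p p0 /eqP rp] := @zariski as_field k f xs y _ genf.
  by have [v vz] := fieldK z0; exists v; rewrite mulrC.
by exists p.
Qed.

End AsField.

Variable R : comNzRingType.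

Lemma quot_surj (I : idealr R) (x : {ideal_quot I}) : exists a, \pi_({ideal_quot I}) a = x.
Proof. by exists (repr x); rewrite reprK. Qed.

Lemma quot_eq0 (I : idealr R) (a : R) : (\pi_({ideal_quot I}) a == 0) = (a \in I).
Proof.
by rewrite -[a in RHS]subr0 Quotient.idealrBE [\pi 0]rmorph0.
Qed.

(** The element a is outside P, so P + (a) cannot be proper, and 1 = p + z * a for some
p in P. *)
Lemma quot_maximal_field (P : idealr R) : maximal_ideal P ->
  forall x : {ideal_quot P}, x != 0 -> exists y, y * x = 1.
Proof.
move=> maxP x; have [a <-] := quot_surj x; rewrite quot_eq0 => aP.
have iP := ideal_idealr P; have iJ := ideal_add_gen a iP.
have [[p pP [z]]|J1] := pselect (add_gen (fun x => x \in P) a 1).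
  move/(congr1 \pi_({ideal_quot P})); rewrite rmorph1 rmorphD rmorphM /=.
  have -> : \pi_({ideal_quot P}) p = 0 by apply/eqP; rewrite quot_eq0.
  by rewrite add0r => e; exists (\pi z).
have [I IJ] := exists_idealr iJ J1; case/negP: aP; apply: (maxP I).
  by move=> y yP; apply/IJ; apply: sub_add_gen.
by apply/IJ; apply: mem_add_gen.
Qed.

End Residue.

Section Generators.
Local Open Scope ring_scope.

Lemma generated_over_comp (A B K : comNzRingType) (f : {rmorphism A -> B})
    (g : {rmorphism B -> K}) xs :
  (forall y, exists x, g x = y) -> generated_over f xs ->
  generated_over (g \o f) (map g xs).
Proof.
move=> gsurj genf E Ef Exs ED EM y; have [x <-] := gsurj y.
apply: (genf (fun x => E (g x))) => // [z zxs|u v|u v].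
- by apply: Exs; apply: map_f.
- by rewrite rmorphD; apply: ED.
- by rewrite rmorphM; apply: EM.
Qed.

Lemma generated_over_mpoly (k : comNzRingType) n :
  generated_over (@mpolyC n k) [seq 'X_i | i <- enum 'I_n].
Proof.
move=> B Bc Bx BD BM; elim/mpolyind => [|c m p _ _ Bp]; first by rewrite -mpolyC0.
apply: BD => //; rewrite -mul_mpolyC; apply: (BM) => //.
rewrite mpolyXE_id; elim/big_ind: _ => [|u v|i _]; [by rewrite -mpolyC1|exact: (BM)|].
elim: (m i) => [|j IHj]; first by rewrite expr0 -mpolyC1.
by rewrite exprS; apply: BM => //; apply: Bx; apply: map_f; rewrite mem_enum.
Qed.

End Generators.

Section Main.
Local Open Scope ring_scope.
Local Open Scope quotient_scope.
Variables (k : fieldType) (V T : finType) (G : sgraph V) (col : V -> T).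
Hypothesis col_clique : forall u v, col u = col v -> u != v -> G u v.
Hypothesis col_surj : forall t, exists v, col v = t.
Local Notation S := {mpoly k[#|V|]}.
Local Notation I := (edge_ideal (k := k) G : idealr S).
Local Notation R := {ideal_quot I}.
Local Notation X := (vertex_var k).

(** The smallest prime contains the product of any two variables from the same fibre,
hence all of the variables of the fibre but at most one.  Modulo this prime, S is
therefore generated by one variable for each fibre. *)
Lemma chain_edge_ideal d (q : nat -> S -> Prop) : chain_of_primes d q ->
  (forall p, p \in I -> q 0%N p) -> (d <= #|T|)%N.
Proof.
move=> ch Iq; have [iq q1 qM] := ch.1 0%N.
have /choice[r rP] (t : T) : exists v, col v = t /\
    forall u, col u = t -> u != v -> q 0%N (X u).
  have [[v vt nqv]|nv] := pselect (exists2 v, col v = t & ~ q 0%N (X v)).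
    exists v; split=> // u ut uv.
    have /Iq/qM[//|//] : X u * X v \in I.
      apply: mem_gen_ideal; apply/mapP; exists (u, v) => //.
      by rewrite mem_enum inE /= col_clique // ut.
  have [v vt] := col_surj t; exists v; split=> // u ut _.
  by apply: contrapT => nqu; apply: nv; exists u.
pose h (i : 'I_#|T|) : S := X (r (enum_val i)).
pose psi : {rmorphism {mpoly k[#|T|]} -> S} := mmap (@mpolyC #|V| k) h.
have psiX t : psi ('X_(enum_rank t)) = X (r t).
  by rewrite /psi /= mmapX mmap1U /h enum_rankK.
have psiC c : psi c%:MP = c%:MP by rewrite /psi /= mmapC.
clearbody psi.
apply: (@chain_of_primes_mpoly k #|T|); apply: (chain_of_primes_pull (f := psi) ch).
apply: (@generated_over_mpoly k #|V|) => [c|y /mapP[i _ ->]|x y [a xa] [b yb]|x y [a xa] [b yb]].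
- by exists c%:MP; rewrite psiC subrr; apply: ideal0.
- rewrite -[i]enum_valK; move: (enum_val i) => v.
  have [vr|vr] := eqVneq v (r (col v)).
    by exists 'X_(enum_rank (col v)); rewrite psiX -vr subrr; apply: ideal0.
  by exists 0; rewrite rmorph0 subr0; apply: (rP (col v)).2.
- exists (a + b); rewrite rmorphD.
  have -> : x + y - (psi a + psi b) = (x - psi a) + (y - psi b) by ring.
  exact: (idealD iq).
- exists (a * b); rewrite rmorphM.
  have -> : x * y - psi a * psi b = y * (x - psi a) + psi a * (y - psi b) by ring.
  by apply: (idealD iq); apply: (idealZ _ iq).
Qed.

Let pi : {rmorphism S -> R} := \pi_R.

Lemma generated_over_edge_ring :
  generated_over (pi \o @mpolyC #|V| k) (map pi [seq 'X_i | i <- enum 'I_#|V|]).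
Proof. by apply: generated_over_comp; [apply: quot_surj|apply: generated_over_mpoly]. Qed.

Lemma noetherian_edge_ring : noetherian R.
Proof.
apply: ideals_fg_noetherian.
exact: (@ideals_fg_generated k R (pi \o @mpolyC #|V| k) _ (@ideals_fg_field k)
  generated_over_edge_ring).
Qed.

Variable P : prime_idealr R.
Local Notation L := (localization P).

Let loc : {rmorphism S -> L} := @to_loc R P \o pi.

Lemma localization_dim d (p : nat -> prime_idealr L) : prime_chain d p -> (d <= #|T|)%N.
Proof.
move=> pch; pose q i (x : L) := x \in p i.
have ch : chain_of_primes d q.
  split=> [i|i id]; last by have [sub [x xp nxp]] := pch i id; split=> //; exists x => //; apply/negP.
  exact: prime_ideal_idealr.
apply: (@chain_edge_ideal _ (fun i x => q i (loc x))); last first.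
  move=> x xI; rewrite /loc /= (_ : pi x = 0) ?rmorph0 ?/q ?idealr0 //.
  by apply/eqP; rewrite quot_eq0.
apply: (@chain_of_primes_preim S L loc (fun t => pi t \notin P) _ _ d q ch) => [t tP|y].
  exact: to_loc_unit.
have [a [s [sP yE]]] := to_loc_den y; have [a' aE] := quot_surj a.
have [s' sE] := quot_surj s; exists a', s'.
by rewrite /loc /= /pi /= aE sE.
Qed.

(** Zariski's lemma applies to R/P, a field that is finitely generated over k; it gives
for each fibre a univariate polynomial whose value at the sum of the fibre lies in P,
and these values form the regular sequence. *)
Lemma localization_cohen_macaulay : decomposable col (independent G) ->
  maximal_ideal P -> local_cohen_macaulay L.
Proof.
move=> decG maxP; have fieldK := quot_maximal_field maxP.
pose K := {ideal_quot P}.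
pose rho : {rmorphism R -> K} := \pi_K.
have gensK := generated_over_comp (@quot_surj R P : forall y, exists x, rho x = y)
  generated_over_edge_ring.
have /choice[f fP] (t : T) : exists f : {poly k}, f != 0 /\
    pi (eval_at f (col_sum k col t)) \in P.
  have [f f0 rf] := zariski_ring fieldK (rho (pi (col_sum k col t))) gensK.
  exists f; split=> //; rewrite -quot_eq0 -[\pi _]/(rho _) /eval_at.
  by rewrite -!horner_map -!map_poly_comp /= rf.
pose gs := [seq eval_at (f t) (col_sum k col t) | t <- enum T].
have gsP : {subset map loc gs <= loc_max (P := P)}.
  by move=> _ /mapP[_ /mapP[t _ ->] ->]; rewrite /loc /= to_loc_max; case: (fP t).
have IE : (fun p : S => is_true (p \in I)) = stanley_reisner (independent G).
  by apply: pred_ext => p; apply: edge_idealE.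
have gsreg : weakly_regular (fun p : S => is_true (p \in I)) gs.
  rewrite IE; apply: decomposable_weakly_regular => //; first exact: down_closed_independent.
    exact: enum_uniq.
  by move=> t _; case: (fP t).
apply: (@local_cohen_macaulay_intro _ (loc_max (P := P)) (map loc gs)) => //.
- exact: is_local_localization.
- apply: (@regular_seq_map _ _ loc (fun p => p \in I) (fun t => pi t \notin P)) => //.
  + exact: ideal_idealr.
  + by move=> x xI; rewrite /loc /= (_ : pi x = 0) ?rmorph0 //; apply/eqP; rewrite quot_eq0.
  + by move=> s t sP tP; rewrite rmorphM notin_primeM.
  + by move=> t tP; apply: to_loc_unit.
  + move=> y; have [a [s [sP yE]]] := to_loc_den y; have [a' aE] := quot_surj a.
    have [s' sE] := quot_surj s; exists a', s'.
    by rewrite /loc /= /pi /= aE sE.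
  + move=> x /to_loc_eq0[u uP]; have [u' uE] := quot_surj u.
    rewrite -uE -rmorphM => /eqP; rewrite quot_eq0 => uI.
    by exists u' => //; rewrite /pi /= uE.
  + by rewrite rmorph1 idealr1.
  + apply/negP => /(@gen_ideal_min _ (fun x => x \in loc_max (P := P))).
    move=> /(_ (ideal_idealr _))/(_ (fun g => @gsP g)); by rewrite idealr1.
- by move=> d p /localization_dim; rewrite cardE !size_map.
Qed.

End Main.

Theorem theorem4p7 (k : fieldType) (r n : nat) (hr : (2 <= r)%N)
  (G : sgraph ('I_r * 'I_n)%type)
  (hpart : forall (a : 'I_r) (i j : 'I_n), ~~ G (a, i) (a, j))
  (h1 : forall (i : 'I_n) (a b : 'I_r), (a < b)%N -> G (a, i) (b, i))
  (h2 : forall (a b : 'I_r) (i j : 'I_n),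
      (a < b)%N -> G (a, i) (b, j) -> (i <= j)%N)
  (h3 : forall (a b : 'I_r) (i j : 'I_n), (a < b)%N ->
      (G (a, i) (b, j) <->
       exists t : (b - a - 1).-tuple 'I_n,
         sorted (fun x y : 'I_n => (x <= y)%N) t /\
         edge_walk G a (i :: rcons t j)))
  (h4 : forall (a b : 'I_r), b = a.+1 :> nat -> forall i j l : 'I_n,
      G (a, i) (b, j) -> G (a, j) (b, l) -> G (a, i) (b, l)) :
  graph_cohen_macaulay k G.
Proof.
have r0 : 0 < r by apply: leq_trans hr.
have clique (u v : 'I_r * 'I_n) : u.2 = v.2 -> u != v -> G u v.
  case: u v => [a i] [b j] /= <-; rewrite xpair_eqE eqxx andbT => ab.
  have [lt_ab|lt_ba|eq_ab] := ltngtP a b; first exact: h1.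
    by rewrite adj_sym; apply: h1.
  by rewrite (val_inj eq_ab) eqxx in ab.
have surj (i : 'I_n) : exists v : 'I_r * 'I_n, v.2 = i by exists (Ordinal r0, i).
have decG : decomposable snd (independent G).
  exact: (decomposable_independent r0 hpart h1 h2 (@adj_split _ _ _ h2 h3) h4).
split; first exact: noetherian_edge_ring.
by move=> P; apply: localization_cohen_macaulay decG.
Qed.
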